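(* Let $G$ be a finite plane graph and $\mathcal{H}$ a collection of connected vertex sets of $G$ that spans $G$. Then there is a fortification $G'$ of $G$ and a collection $\mathcal{M}$ such that $\mathcal{H}$ $8$-spans $G'$ and $(G',\mathcal{M})$ is a $(73936,80)$-impression of $(G',\mathcal{H})$.
   Context: A plane graph is a planar graph with a fixed embedding; the outer face is the unbounded face. Vertex set $A$ is connected if $G[A]$ is connected. $\mathcal{H}$ spans $G$ if every edge of $G$ has both ends in some member of $\mathcal{H}$. $\mathbf{RIG}(X,\mathcal{C})$ is the graph on $\mathcal{C}$ with distinct members adjacent iff they intersect. $\mathcal{C}$ $z$-spans $X$ if for every edge $uv$ of $X$ there exist $C_u\ni u$, $C_v\ni v$ in $\mathcal{C}$ with $d_{\mathbf{RIG}(X,\mathcal{C})}(C_u,C_v)\le z$. Weak diameter of $A$ in graph $Y$: $\max_{a,b\in A}d_Y(a,b)$. $I_{\mathcal{C}}(F)$: members of $\mathcal{C}$ meeting $F$. Disjoint sets touch if an edge joins them; $\mathbf{IM}(X,\mathcal{M})$ is the graph on a collection $\mathcal{M}$ of pairwise disjoint connected sets with distinct members adjacent iff they touch. $(X,\mathcal{M})$ is an $(x,y)$-impression of $(X,\mathcal{C})$ if $\mathcal{M}$ consists of pairwise disjoint connected sets of $X$ with union $V(X)$, $I_{\mathcal{C}}(M)$ has weak diameter $\le x$ in $\mathbf{RIG}(X,\mathcal{C})$ for each $M\in\mathcal{M}$, and $I_{\mathcal{M}}(C)$ has weak diameter $\le y$ in $\mathbf{IM}(X,\mathcal{M})$ for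 each $C\in\mathcal{C}$. If an edge $e$ is drawn inside a face of $G$, it splits that face into two regions, the sides of $e$. A plane graph $G'$ is a fortification of $G$ if it is obtained from $G$ by adding edges drawn inside faces of $G$ such that one can choose a side $F_e$ of each new edge $e$ with the interiors of $F_e,F_{e'}$ disjoint for distinct new edges, and no $F_e$ containing an edge incident to the outer face of $G$. *)

(* Defs.v *)
From HB Require Import structures.
From mathcomp Require Import all_boot all_order all_algebra.
From mathcomp Require Import mathcomp_extra boolp classical_sets functions.
From mathcomp Require Import set_interval reals topology normedtype.

Set Implicit Arguments.
Unset Strict Implicit.
Unset Printing Implicit Defensive.

Import Order.TTheory GRing.Theory Num.Theory.
Import numFieldNormedType.Exports.

(** Graphs on a finite type [T] are relations [e : rel T]. *)

Section Graphs.
Variable T : finType.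
Implicit Types (e : rel T) (A B : {set T}) (C M : {set {set T}}).

(* The distance between x and y in e is at most n; no walk means an infinite
   distance. *)
Definition dist_le e (n : nat) (x y : T) : Prop :=
  exists p : seq T, [/\ path e x p, last x p = y & size p <= n].

Definition weak_diam_le e A (n : nat) : Prop :=
  {in A &, forall a b, dist_le e n a b}.

Definition induced e A : rel T :=
  [rel u v | [&& u \in A, v \in A & e u v]].

(* Connected graphs are nonempty. *)
Definition connected_set e A : Prop :=
  A != finset.set0 /\ {in A &, forall u v, connect (induced e A) u v}.

Definition spans e C : Prop :=
  forall u v, e u v -> exists2 A, A \in C & (u \in A) && (v \in A).

Definition meeting C A : {set {set T}} :=
  [set B in C | ~~ [disjoint B & A]]%SET.

Definition touch e A B : bool := [exists u in A, exists v in B, e u v].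

End Graphs.

Section Collections.
Variable T : finType.
Implicit Types (e : rel T) (C M : {set {set T}}).

(* RIG and IM are graphs on the members of the collection; sets outside the
   collection are isolated in the relations below. *)
Definition RIG C : rel {set T} :=
  [rel A B | [&& A \in C, B \in C, A != B & ~~ [disjoint A & B]]].

Definition IM e M : rel {set T} :=
  [rel A B | [&& A \in M, B \in M, A != B & touch e A B]].

Definition zspans e C (z : nat) : Prop :=
  forall u v, e u v -> exists Cu Cv : {set T},
    [/\ Cu \in C, Cv \in C, u \in Cu, v \in Cv & dist_le (RIG C) z Cu Cv].

Definition impression e C M (x y : nat) : Prop :=
  [/\ {in M, forall A, connected_set e A},
      finset.trivIset M,
      finset.cover M = [set: T]%SET,
      {in M, forall A, weak_diam_le (RIG C) (meeting C A) x} &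
      {in C, forall A, weak_diam_le (IM e M) (meeting M A) y}].

End Collections.

Local Open Scope ring_scope.
Local Open Scope classical_set_scope.

Section PlaneGraphs.
Variable R : realType.

(* A is a simple arc in the plane with ends a and b. *)
Definition is_arc (a b : R * R) (A : set (R * R)) : Prop :=
  exists f : R -> R * R,
    [/\ {within `[0, 1], continuous f},
        {in `[0, 1] &, injective f},
        f 0 = a, f 1 = b & A = f @` `[0, 1]].

(* A finite simple graph drawn in the plane. An edge is the set of its two
   ends; [curve] is only relevant on [edges], where it is the closed arc that
   represents the edge. *)
Record plane_graph (V : finType) := PlaneGraph {
  pos : V -> R * R;
  edges : {set {set V}};
  curve : {set V} -> set (R * R);
  pos_inj : injective pos;
  edge_arc : forall e, e \in edges -> exists u v : V,
    [/\ u != v, e = [set u; v]%SET & is_arc (pos u) (pos v) (curve e)];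
  edge_vertex : forall e w, e \in edges -> curve e (pos w) -> w \in e;
  edge_edge : forall e e', e \in edges -> e' \in edges -> e != e' ->
    curve e `&` curve e' `<=` range pos
}.

Variable V : finType.
Implicit Types (G : plane_graph V) (F S : set (R * R)) (e : {set V}).

Definition adj G : rel V := [rel u v | [set u; v]%SET \in edges G].

Definition drawing G : set (R * R) :=
  range (pos G) `|` \bigcup_(e in [set` edges G]) curve G e.

Definition face G F : Prop :=
  exists2 p, (~` drawing G) p & F = connected_component (~` drawing G) p.

Definition outer_face G F : Prop := face G F /\ ~ bounded_set F.

Definition incident G e F : Prop := curve G e `<=` closure F.

(* Sides are taken closed: faces are open and disjoint from the drawing, so only
   a closed side can contain an edge of G. If A joins two components of the
   graph then F `\` A is connected and its closure is the only side. *)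
Definition side F (A S : set (R * R)) : Prop :=
  exists2 p, (F `\` A) p & S = closure (connected_component (F `\` A) p).

Definition fortification G G' : Prop :=
  [/\ pos G' =1 pos G,
      edges G \subset edges G',
      {in edges G, curve G' =1 curve G} &
      exists Fe : {set V} -> set (R * R),
      [/\ {in edges G' :\: edges G, forall e,
            exists F, [/\ face G F,
                          curve G' e `\` range (pos G) `<=` F &
                          side F (curve G' e) (Fe e)]},
          {in edges G' :\: edges G &, forall e e', e != e' ->
            (Fe e)° `&` (Fe e')° = set0} &
          {in edges G' :\: edges G, forall e,
            forall F e0, outer_face G F -> e0 \in edges G ->
              incident G e0 F -> ~ curve G e0 `<=` Fe e}]].

Lemma adj_sym G : symmetric (adj G).
Proof. by move=> u v; rewrite /adj /= finset.setUC. Qed.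

Lemma adj_irrefl G : irreflexive (adj G).
Proof.
move=> u; apply/negP => /edge_arc [v [w [nvw /setP E _]]]; move: nvw.
move: (E v) (E w); rewrite !inE !eqxx ?orbT !orbb => /eqP-> /eqP->.
by rewrite eqxx.
Qed.

End PlaneGraphs.

(* Main.v *)
(* No new edge is needed: G' = G works, and planarity only enters through the
   absence of a K_5 minor.

   Measure distances inside a vertex set U by the number of pieces of members of
   H (components of their traces on U) that have to be chained. The vertices are
   handed over to owners step by step. Every component C of the vertices that are
   still free carries a bag of owners. If all of them touch C, they are at most
   three, since together with C they form a clique minor; a new owner is created,
   whose core is a tripod of geodesics of C that touches the old ones. If some
   owner of the bag has been cut off from C, the younger owners around C absorb
   the vertices of C at distance at most one from them, oldest first, and the
   owners that are cut off leave the bag. An owner does so a bounded number of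
   times, so its vertices stay close to its core, and cutting the cores into long
   blocks yields the cells of the impression. Inside a connected part of a member
   of H, the cells of the vertices of the oldest owner are equal or adjacent, and
   there are at most four owners to be peeled off.

   For the absence of a K_5 minor, the drawing is rounded to a grid so fine that
   disjoint edges stay disjoint. Count modulo 2 how the lattice paths cross the
   vertical rays above the five branch points: every ray is counted twice, but of
   the three pairings of four points on a line exactly one is interleaved, and
   there are five quadruples. *)
Require Import Defs.
From HB Require Import structures.
From mathcomp Require Import all_boot all_order all_algebra.
From mathcomp Require Import reals.
From mathcomp Require Import zify ring lra.
From Stdlib Require Import Btauto.

Set Implicit Arguments.
Unset Strict Implicit.
Unset Printing Implicit Defensive.

Import Order.TTheory GRing.Theory Num.Theory.

(** * Distances and components in finite graphs *)

Section Distance.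
Variable T : finType.
Implicit Types (e : rel T) (A : {set T}) (x y z : T) (m n : nat).

Lemma dist_le_refl e n x : dist_le e n x x.
Proof. by exists [::]. Qed.

Lemma dist_le1 e x y : e x y -> dist_le e 1 x y.
Proof. by move=> exy; exists [:: y]; rewrite /= exy. Qed.

Lemma dist_le_leq e m n x y : m <= n -> dist_le e m x y -> dist_le e n x y.
Proof. by move=> mn [p [? ? pm]]; exists p; split=> //; apply: leq_trans mn. Qed.

Lemma dist_le_trans e m n x y z :
  dist_le e m x y -> dist_le e n y z -> dist_le e (m + n) x z.
Proof.
case=> p [pp <- pm] [q [pq <- qn]]; exists (p ++ q).
by rewrite cat_path last_cat size_cat pp pq; split=> //; apply: leq_add.
Qed.

Lemma dist_le_sym e n x y : symmetric e -> dist_le e n x y -> dist_le e n y x.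
Proof.
move=> e_sym [p [pp <- pn]]; exists (rev (belast x p)); split.
- by rewrite rev_path; apply: sub_path pp => u v; rewrite e_sym.
- by case: p {pp pn} => [|z p] //=; rewrite rev_cons last_rcons.
- by rewrite size_rev size_belast.
Qed.

Lemma dist_le_sub e e' n x y : subrel e e' -> dist_le e n x y -> dist_le e' n x y.
Proof. by move=> ee' [p [pp ? ?]]; exists p; split=> //; apply: sub_path pp. Qed.

Lemma connect_dist_le e x y : connect e x y -> dist_le e #|T| x y.
Proof.
case/connectP=> p pp ->; have [q pq uq _] := shortenP pp.
exists q; split=> //; apply: ltnW.
by have := max_card [in x :: q]; rewrite (card_uniqP uq).
Qed.

Fixpoint within e A n : {set T} :=
  if n is n'.+1 then
    within e A n' :|: [set y | [exists x in within e A n', e x y]]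
  else A.

Lemma withinP e A n y :
  reflect (exists2 x, x \in A & dist_le e n x y) (y \in within e A n).
Proof.
apply: (iffP idP) => [|[x xA [p [pp <- pn]]]].
  elim: n y => [|n IHn] y /=; first by exists y => //; apply: dist_le_refl.
  rewrite !inE => /orP[/IHn[x xA xy]|/exists_inP[z /IHn[x xA xz] zy]].
    by exists x => //; apply: dist_le_leq xy.
  by exists x => //; rewrite -addn1; apply: dist_le_trans xz (dist_le1 zy).
elim: n p pp pn => [|n IHn] p; first by case: p.
case/lastP: p => [_ _|p z] /=; first by rewrite inE (IHn [::]).
rewrite rcons_path last_rcons size_rcons ltnS => /andP[pp lasty] pn.
by rewrite !inE; apply/orP; right; apply/exists_inP; exists (last x p); rewrite ?IHn.
Qed.

(* [#|T|.+1] if [x] cannot be reached from [A]. *)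
Definition dist_from e A x := find (fun n => x \in within e A n) (iota 0 #|T|.+1).

Lemma dist_from_le e A n x : x \in within e A n -> dist_from e A x <= n.
Proof.
move=> xn; rewrite leqNgt; apply/negP => lt_n.
have := before_find 0 lt_n; rewrite nth_iota ?add0n ?xn //.
by apply: leq_trans lt_n _; rewrite -[X in _ <= X](size_iota 0) find_size.
Qed.

Definition reachable e A x : Prop := exists2 a, a \in A & connect e a x.

Lemma mem_within_dist_from e A x :
  reachable e A x -> x \in within e A (dist_from e A x).
Proof.
case=> a aA /connect_dist_le ax.
have xA : has (fun n => x \in within e A n) (iota 0 #|T|.+1).
  by apply/hasP; exists #|T|; [rewrite mem_iota /= | apply/withinP; exists a].
have := nth_find 0 xA; rewrite nth_iota ?add0n //.
by rewrite -[X in _ < X](size_iota 0) -has_find.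
Qed.

Lemma dist_from_lipschitz e A n x y :
  reachable e A x -> dist_le e n x y -> dist_from e A y <= dist_from e A x + n.
Proof.
move=> /mem_within_dist_from/withinP[a aA ax] xy.
by apply/dist_from_le/withinP; exists a => //; apply: dist_le_trans xy.
Qed.

Lemma dist_from_eq0 e A x : (dist_from e A x == 0) = (x \in A).
Proof. by rewrite /dist_from /=; case: ifP. Qed.

End Distance.

Section Components.
Variables (V : finType) (g : rel V).
Hypothesis g_sym : symmetric g.
Implicit Types (K U X : {set V}) (P : pred V) (u v x y : V).

Lemma connect_induced_sym X : connect_sym (induced g X).
Proof.
by apply: sym_connect_sym => x y; rewrite /induced /= g_sym andbCA.
Qed.

Lemma connect_induced_sub X U x y : X \subset U ->
  connect (induced g X) x y -> connect (induced g U) x y.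
Proof.
move=> /subsetP sXU; apply: connect_sub => u v /and3P[uX vX guv].
by apply: connect1; rewrite /induced /= !sXU.
Qed.

Lemma connect_induced_mem X x y :
  x \in X -> connect (induced g X) x y -> y \in X.
Proof.
move=> xX /connectP[p]; elim: p x xX => [|z p IHp] x xX /=; first by move=> _ ->.
by case/andP=> /and3P[_ zX _] pz /(IHp _ zX pz).
Qed.

Lemma connect_induced1 X x y :
  x \in X -> y \in X -> g x y -> connect (induced g X) x y.
Proof. by move=> xX yX gxy; apply: connect1; apply/and3P. Qed.

Lemma connect_induced_exit X P x y :
  connect (induced g X) x y -> P x -> ~~ P y ->
  exists u v, [/\ u \in X, v \in X, P u & ~~ P v] /\
    [/\ g u v & connect (induced g [set z in X | P z]) x u].
Proof.
move=> /connectP[p]; elim: p x => [|z p IHp] x /=; first by move=> _ -> ->.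
case/andP=> /and3P[xX zX gxz] pz lasty Px nPy.
have [Pz|nPz] := boolP (P z); last by exists x, z.
have [u [v [uv [guv zu]]]] := IHp _ pz lasty Pz nPy.
exists u, v; split=> //; split=> //; apply: connect_trans zu.
by apply: connect_induced1; rewrite // inE ?xX ?zX.
Qed.

Definition component U u : {set V} := [set x in U | connect (induced g U) u x].

Lemma mem_component U u : u \in U -> u \in component U u.
Proof. by move=> uU; rewrite inE uU connect0. Qed.

Lemma component_sub U u : component U u \subset U.
Proof. by apply/subsetP => x; rewrite inE => /andP[]. Qed.

Lemma component_eq U u x : x \in component U u -> component U x = component U u.
Proof.
rewrite inE => /andP[xU ux]; apply/setP => y; rewrite !inE; congr (_ && _).
by rewrite (same_connect (connect_induced_sym U) ux).
Qed.

Lemma component_closed U u x y :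
  x \in component U u -> y \in U -> g x y -> y \in component U u.
Proof.
rewrite !inE => /andP[xU ux] yU gxy; rewrite yU; apply: connect_trans ux _.
exact: connect_induced1.
Qed.

Lemma connect_component U u x :
  u \in U -> connect (induced g U) u x -> connect (induced g (component U u)) u x.
Proof.
move=> uU /connectP[p pp ->]; elim/last_ind: p pp => [|p z IHp] //.
rewrite rcons_path last_rcons => /andP[pp /and3P[lU zU glz]].
apply: connect_trans (IHp pp) _.
have lu : last u p \in component U u by rewrite inE lU; apply/connectP; exists p.
by apply: connect_induced1 => //; apply: component_closed glz.
Qed.

Lemma component_connected U u : u \in U -> connected_set g (component U u).
Proof.
move=> uU; split; first by apply/set0Pn; exists u; apply: mem_component.
move=> x y; rewrite !inE => /andP[xU ux] /andP[yU uy].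
apply: connect_trans (connect_component uU uy).
by rewrite connect_induced_sym; apply: connect_component.
Qed.

Lemma component_max U u K :
  connected_set g K -> K \subset U -> u \in K -> K \subset component U u.
Proof.
move=> [_ K_conn] sKU uK; apply/subsetP => x xK; rewrite inE (subsetP sKU) //=.
by apply: connect_induced_sub sKU _; apply: K_conn.
Qed.

Lemma component_mono X U u :
  X \subset U -> u \in X -> component X u \subset component U u.
Proof.
move=> sXU uX; apply: component_max; last exact: mem_component.
  exact: component_connected.
exact: subset_trans (component_sub _ _) sXU.
Qed.

Lemma component_edge U u x y :
  x \in U -> y \in U -> g x y -> (x \in component U u) = (y \in component U u).
Proof.
move=> xU yU gxy; apply/idP/idP => /component_closed; first by apply.
by apply=> //; rewrite g_sym.
Qed.

Lemma component_exit U K u x :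
  connected_set g K -> x \in K -> x \in component U u -> ~~ (K \subset component U u) ->
  exists y z, [/\ y \in component (K :&: component U u) x, y \in component U u,
                  z \in K, z \notin U & g y z].
Proof.
set C := component U u => -[_ K_conn] xK xC /subsetPn[w wK wC].
have xKC : x \in K :&: C by rewrite inE xK.
have [||y [z [[yK zK yx zx] [gyz _]]]] := @connect_induced_exit K
    (fun t => t \in component (K :&: C) x) _ _ (K_conn x w xK wK).
- exact: mem_component.
- by apply: contra wC => /(subsetP (component_sub _ _))/setIP[].
have yC : y \in C by move/(subsetP (component_sub _ _))/setIP: yx => [].
exists y, z; split=> //; apply: contra zx => zU.
apply: (component_closed yx _ gyz).
by rewrite inE zK; apply: (component_closed yC).
Qed.

Lemma component_far U X u x : X \subset U -> U :\: component U u \subset X ->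
  x \in U :\: component U u -> component X x = component U x.
Proof.
move=> sXU /subsetP far x_far; have xX := far x x_far; have [xU xu] := setDP x_far.
apply/eqP; rewrite eqEsubset component_mono //=; apply: component_max.
- exact: component_connected.
- apply/subsetP => y yx; apply: far.
  rewrite inE (subsetP (component_sub _ _) _ yx) andbT.
  by apply: contra xu => /component_eq <-; rewrite (component_eq yx) mem_component.
- exact: mem_component.
Qed.

End Components.

(** * Link distance and tripods *)

Section Links.
Variables (V : finType) (g : rel V) (H : {set {set V}}).
Hypothesis g_sym : symmetric g.
Implicit Types (A K U W : {set V}) (x y : V).

(* The pieces of [A \in H] in [U] are the components of [A :&: U]; two vertices
   are linked in [U] if they are equal or lie in a common piece. *)
Definition linked U : rel V := [rel x y | (x == y) ||
  [exists A in H, [&& x \in A :&: U, y \in A :&: U &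
                      connect (induced g (A :&: U)) x y]]].

Lemma linked_refl U : reflexive (linked U).
Proof. by move=> x; rewrite /linked /= eqxx. Qed.

Lemma linked_sym U : symmetric (linked U).
Proof.
suff h x y : linked U x y -> linked U y x by move=> x y; apply/idP/idP => /h.
case/orP=> [/eqP->|/exists_inP[A AH /and3P[xA yA xy]]]; first exact: linked_refl.
by apply/orP; right; apply/exists_inP; exists A; rewrite // xA yA connect_induced_sym.
Qed.

Lemma linked_sub U W : U \subset W -> subrel (linked U) (linked W).
Proof.
move=> sUW x y /orP[xy|/exists_inP[A AH /and3P[xA yA xy]]]; first by apply/orP; left.
apply/orP; right; have sA : A :&: U \subset A :&: W by rewrite setIS.
by apply/exists_inP; exists A; rewrite // !(subsetP sA) //= (connect_induced_sub sA).
Qed.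

Lemma linked_connected U K A x y : A \in H -> K \subset A -> K \subset U ->
  x \in K -> connect (induced g K) x y -> linked U x y.
Proof.
move=> AH sKA sKU xK xy; have yK := connect_induced_mem xK xy.
have sK : K \subset A :&: U by rewrite subsetI sKA.
apply/orP; right; apply/exists_inP; exists A => //.
by rewrite !(subsetP sK) //= (connect_induced_sub sK).
Qed.

Lemma linked_piece U x y : x \in U -> linked U x y -> exists W,
  [/\ W \subset U, connected_set g W, x \in W, y \in W &
      {in W &, forall w w', linked U w w'}].
Proof.
move=> xU /orP[/eqP <-|/exists_inP[A AH /and3P[xA yA xy]]].
  exists [set x]; rewrite sub1set set11; split=> // [|w w' /set1P-> /set1P->].
    split; first by apply/set0Pn; exists x; apply: set11.
    by move=> w w' /set1P-> /set1P->.
  exact: linked_refl.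
have W_conn := component_connected g_sym xA; have W_sub := component_sub g (A :&: U) x.
exists (component g (A :&: U) x); split=> //.
- exact: subset_trans W_sub (subsetIr _ _).
- exact: mem_component.
- by rewrite inE yA.
move=> w w' wW w'W; apply: linked_connected AH _ _ wW (W_conn.2 _ _ wW w'W).
  exact: subset_trans W_sub (subsetIl _ _).
exact: subset_trans W_sub (subsetIr _ _).
Qed.

Hypothesis g_spans : spans g H.

Lemma linked_edge U x y : x \in U -> y \in U -> g x y -> linked U x y.
Proof.
move=> xU yU gxy; have [A AH /andP[xA yA]] := g_spans gxy.
apply: (@linked_connected U (A :&: U) A); rewrite ?subsetIl ?subsetIr ?inE ?xA //.
by apply: connect_induced1; rewrite ?inE ?xA ?yA.
Qed.

Lemma connect_linked U x y : connect (induced g U) x y -> connect (linked U) x y.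
Proof.
by apply: connect_sub => u v /and3P[uU vU guv]; apply: connect1; apply: linked_edge.
Qed.

End Links.

Definition slice (V : finType) (f : V -> nat) (S : {set V}) (w w' : V) : {set V} :=
  [set z in S | minn (f w) (f w') <= f z <= maxn (f w) (f w')].

Lemma sliceC (V : finType) (f : V -> nat) (S : {set V}) w w' :
  slice f S w w' = slice f S w' w.
Proof. by rewrite /slice minnC maxnC. Qed.

Section Threads.
Variables (V : finType) (g : rel V) (H : {set {set V}}).
Hypothesis g_sym : symmetric g.
Implicit Types (A C K L S T U : {set V}) (f r leg : V -> nat) (a b c p x y : V).
Local Notation linked := (linked g H).

(* A connected substitute for a geodesic from [x] to [a]: here [f] is the link
   distance from a set that the thread only meets at [a]. *)
Record thread U f x a S : Prop := Thread {
  thread_sub : S \subset U;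
  thread_start : x \in S;
  thread_end : a \in S;
  thread_end0 : f a = 0;
  thread_eq0 : {in S, forall w, f w = 0 -> w = a};
  thread_le : {in S, forall w, f w <= f x};
  thread_dist_end : {in S, forall w, dist_le (linked U) (f w) w a};
  thread_dist : {in S &, forall w w', dist_le (linked U) `|f w - f w'|%N.+1 w w'};
  thread_connect : {in S &, forall w w', connect (induced g (slice f S w w')) w w'}
}.

Lemma thread_nil U f a : a \in U -> f a = 0 -> thread U f a a [set a].
Proof.
move=> aU fa0; split=> [|||//|w|w|w|w w'|w w'];
  rewrite ?sub1set ?set11 // !inE => /eqP-> //.
- exact: dist_le_refl.
- by move=> /eqP->; apply: dist_le_refl.
- by move=> /eqP->; apply: connect0.
Qed.

Section Cons.
Variables (U S L : {set V}) (f : V -> nat) (x y u a : V).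
Hypothesis S_thread : thread U f y a S.
Hypothesis L_sub : L \subset U.
Hypothesis L_connected : connected_set g L.
Hypothesis L_level : {in L, forall w, f w = (f y).+1}.
Hypothesis L_linked : {in y |: L &, forall w w', linked U w w'}.
Hypothesis (xL : x \in L) (uL : u \in L) (guy : g u y).

Let yS : y \in S. Proof. exact: thread_start S_thread. Qed.

Let linkL_y w : w \in L -> dist_le (linked U) 1 w y.
Proof. by move=> wL; apply/dist_le1/L_linked; rewrite ?setU11 ?setU1r. Qed.

Let dist_L_S w w' : w \in L -> w' \in S -> dist_le (linked U) `|f w - f w'|%N.+1 w w'.
Proof.
move=> wL w'S; have := dist_le_trans (linkL_y wL) (thread_dist S_thread yS w'S).
by apply: dist_le_leq; have := thread_le S_thread w'S; rewrite (L_level wL); clear; lia.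
Qed.

Let connect_L_S w w' : w \in L -> w' \in S ->
  connect (induced g (slice f (L :|: S) w w')) w w'.
Proof.
move=> wL w'S; have fw' := thread_le S_thread w'S; have fw := L_level wL.
have sub_L : L \subset slice f (L :|: S) w w'.
  by apply/subsetP => z zL; rewrite !inE zL /= (L_level zL) -fw geq_minl leq_maxl.
have sub_S : slice f S y w' \subset slice f (L :|: S) w w'.
  by apply/subsetP => z; rewrite !inE => /andP[-> /=]; rewrite orbT;
    move: fw fw'; clear; lia.
have y_slice : y \in slice f S y w' by rewrite inE yS geq_minl leq_maxl.
apply: (@connect_trans _ _ u);
  first exact: connect_induced_sub sub_L (L_connected.2 _ _ wL uL).
apply: (@connect_trans _ _ y).
  by apply: connect_induced1 guy; [apply: subsetP uL | apply: subsetP y_slice].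
exact: connect_induced_sub sub_S (thread_connect S_thread yS w'S).
Qed.

Lemma thread_cons : thread U f x a (L :|: S).
Proof.
have fx := L_level xL; have f_le := thread_le S_thread.
split=> [||||w|w|w|w w'|w w'].
- by rewrite subUset L_sub (thread_sub S_thread).
- by rewrite inE xL.
- by rewrite inE (thread_end S_thread) orbT.
- exact: thread_end0 S_thread.
- by case/setUP=> [/L_level->//|]; apply: thread_eq0 S_thread _.
- by case/setUP=> [/L_level->|/f_le]; lia.
- case/setUP=> [wL|]; last exact: thread_dist_end S_thread _.
  by rewrite (L_level wL) -add1n;
    apply: dist_le_trans (linkL_y wL) (thread_dist_end S_thread yS).
- case/setUP=> [wL|wS] /setUP[w'L|w'S].
  + rewrite (L_level wL) (L_level w'L) distnn; apply: dist_le1.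
    by apply: L_linked; rewrite setU1r.
  + exact: dist_L_S.
  + by rewrite distnC; apply: dist_le_sym (dist_L_S w'L wS); apply: linked_sym.
  + exact: thread_dist S_thread _ _ wS w'S.
- case/setUP=> [wL|wS] /setUP[w'L|w'S].
  + apply: connect_induced_sub (L_connected.2 _ _ wL w'L); apply/subsetP => z zL.
    by rewrite !inE zL (L_level wL) (L_level w'L) (L_level zL) minnn maxnn leqnn.
  + exact: connect_L_S.
  + by rewrite connect_induced_sym // sliceC; apply: connect_L_S.
  + apply: connect_induced_sub (thread_connect S_thread wS w'S); apply/subsetP => z.
    by rewrite !inE => /andP[-> ->]; rewrite orbT.
Qed.

End Cons.

Section ThreadExists.
Variables (U A : {set V}).
Hypothesis U_reachable : {in U, forall x, reachable (linked U) A x}.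
Let f := dist_from (linked U) A.

Lemma dist_from_linked_descend x : x \in U -> 0 < f x ->
  exists L y u, [/\ L \subset U, x \in L, connected_set g L,
      {in L, forall w, f w = (f y).+1} & {in y |: L &, forall w w', linked U w w'}] /\
    [/\ y \in U, u \in L & g u y].
Proof.
move=> xU fx0; have [n fx] : exists n, f x = n.+1 by exists (f x).-1; rewrite prednK.
have := mem_within_dist_from (U_reachable xU); rewrite -/f fx !inE.
case/orP=> [/dist_from_le|/exists_inP[z zA]]; rewrite -/f ?fx ?ltnn //.
have lip w w' : w \in U -> linked U w w' -> f w' <= (f w).+1.
  move=> wU ww'; rewrite -addn1.
  exact: dist_from_lipschitz (U_reachable wU) (dist_le1 ww').
have fz : f z <= n by apply: dist_from_le.
rewrite linked_sym // => /(linked_piece g_sym xU)[W [WU [_ W_conn] xW zW W_linked]].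
have fW w : w \in W -> n <= f w <= n.+1.
  move=> wW; have := lip _ _ (subsetP WU w wW) (W_linked _ _ wW xW).
  have := lip _ _ (subsetP WU z zW) (W_linked _ _ zW wW); rewrite fx ltnS => fwz ->.
  exact: leq_trans fwz _.
have [||u [y [[uW yW /eqP fu fy] [guy xu]]]] :=
    @connect_induced_exit _ g W (fun w => f w == n.+1) x z (W_conn _ _ xW zW).
- by rewrite fx.
- by rewrite neq_ltn ltnS fz.
have {}fy : f y = n.
  by apply/eqP; have := fW _ yW; rewrite eqn_leq [_ <= n.+1]leq_eqVlt (negPf fy) andbC.
set top := [set w in W | f w == n.+1] in xu.
have xtop : x \in top by rewrite inE xW fx eqxx.
have LW w : w \in component g top x -> w \in W /\ f w = n.+1.
  by move/(subsetP (component_sub _ _ _)); rewrite inE => /andP[? /eqP].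
exists (component g top x), y, u; split; split; rewrite ?fy.
- by apply/subsetP => w /LW[wW _]; apply: (subsetP WU).
- exact: mem_component.
- exact: component_connected.
- by move=> w /LW[].
- have LW' w : w \in y |: component g top x -> w \in W by case/setU1P=> [->|/LW[]].
  by move=> w w' /LW' wW /LW'; apply: W_linked.
- exact: (subsetP WU).
- by rewrite 2!inE uW fu eqxx.
- exact: guy.
Qed.

Lemma thread_exists x : x \in U -> exists S a, a \in A /\ thread U f x a S.
Proof.
move En: (f x) => n; elim: n x En => [|n IHn] x fx xU.
  exists [set x], x; have xA : x \in A by rewrite -(dist_from_eq0 (linked U)) -/f fx.
  by split=> //; apply: thread_nil.
have [|L [y [u [[LU xL L_conn fL L_linked] [yU uL guy]]]]] :=
  dist_from_linked_descend xU.
  by rewrite fx.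
have fy : f y = n by apply/eqP; rewrite -eqSS -fx -(fL x).
have [S [a [aA Sy]]] := IHn y fy yU.
by exists (L :|: S), a; split=> //; apply: thread_cons Sy _ _ _ _ _ uL guy.
Qed.

End ThreadExists.

End Threads.

Lemma distn_div (l x y : nat) : `|x - y|%N < l -> `|x %/ l - y %/ l|%N <= 1.
Proof.
wlog le_xy : x y / x <= y => [wlog_le|].
  by case: (leqP x y) => [|/ltnW] /wlog_le //; rewrite (distnC y) (distnC (y %/ l)%N).
rewrite (distnEr le_xy) (distnEr (leq_div2r l le_xy)) => lt_l.
have l_gt0 : 0 < l by apply: leq_ltn_trans lt_l.
rewrite leq_subLR addn1; apply: leq_trans (leq_div2r l (_ : y <= x + l)) _; first lia.
by rewrite divnDr // divnn l_gt0 addn1.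
Qed.

Section Cores.
Variables (V : finType) (g : rel V) (H : {set {set V}}).
Hypothesis g_sym : symmetric g.
Implicit Types (C R T : {set V}) (r leg : V -> nat) (p w x y z : V) (l m n : nat).
Local Notation linked := (linked g H).

(* Blocks of link diameter about [l], two-coloured so that near vertices of one
   colour share their block. *)
Record block_system R T l (blk : V -> nat * nat) (col : V -> bool) : Prop :=
BlockSystem {
  block_colour : {in T &, forall w w' n, col w = col w' ->
    dist_le (linked R) n w w' -> n < l -> blk w = blk w'};
  block_diam : {in T &, forall w w', blk w = blk w' -> dist_le (linked R) (2 * l) w w'};
  block_touch : {in T &, forall w w' n, dist_le (linked R) n w w' -> n < l ->
    blk w = blk w' \/ exists x y,
      [/\ x \in T, y \in T, blk x = blk w, blk y = blk w' & g x y]};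
  block_connect : {in T &, forall w w', blk w = blk w' ->
    connect (induced g [set x in T | blk x == blk w]) w w'}
}.

Definition core R T : Prop :=
  forall l, 0 < l -> exists blk col, block_system R T l blk col.

Definition same_leg r leg w w' : bool := [|| r w == 0, r w' == 0 | leg w == leg w'].

Definition leg_slice r leg T w w' : {set V} :=
  [set z in slice r T w w' | same_leg r leg z w && same_leg r leg z w'].

(* [r] is the distance from the centre [p], and [leg] the branch of a vertex. *)
Record tripod R T r leg p : Prop := Tripod {
  tripod_center : p \in T;
  tripod_center0 : r p = 0;
  tripod_near : {in T &, forall w w' n, same_leg r leg w w' ->
    dist_le (linked R) n w w' -> `|r w - r w'|%N <= n};
  tripod_cross : {in T &, forall w w' n, ~~ same_leg r leg w w' ->
    dist_le (linked R) n w w' -> minn (r w) (r w') <= n /\ maxn (r w) (r w') <= 2 * n};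
  tripod_dist : {in T &, forall w w', same_leg r leg w w' ->
    dist_le (linked R) `|r w - r w'|%N.+1 w w'};
  tripod_connect : {in T &, forall w w', same_leg r leg w w' ->
    connect (induced g (leg_slice r leg T w w')) w w'}
}.

Section TripodCore.
Variables (R T : {set V}) (r leg : V -> nat) (p : V) (l : nat).
Hypothesis T_tripod : tripod R T r leg p.
Hypothesis l_gt0 : 0 < l.

Let pT : p \in T. Proof. exact: tripod_center T_tripod. Qed.
Let rp : r p = 0. Proof. exact: tripod_center0 T_tripod. Qed.

Let same_leg_center w : same_leg r leg w p /\ same_leg r leg p w.
Proof. by rewrite /same_leg rp eqxx orbT. Qed.

Definition tripod_block w : nat * nat := (r w %/ l, if r w < l then 0 else leg w).
Local Notation blk := tripod_block.

Let div_eq0 (x : nat) : (x %/ l == 0) = (x < l).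
Proof. by rewrite -leqn0 leqNgt divn_gt0 // -ltnNge. Qed.

Lemma tripod_block_center w : r w < l -> blk w = blk p.
Proof. by rewrite /blk rp l_gt0 => rw; rewrite rw div0n divn_small. Qed.

Lemma tripod_block_eq w w' :
  same_leg r leg w w' -> r w %/ l = r w' %/ l -> blk w = blk w'.
Proof.
move=> ww' e; rewrite /blk -!div_eq0 e div_eq0; congr (_, _).
case: ltnP => // rw'; have rw : l <= r w by rewrite leqNgt -div_eq0 e div_eq0 -leqNgt.
by case/or3P: ww' => [/eqP r0|/eqP r0|/eqP//]; [move: rw | move: rw'];
  rewrite r0 leqNgt l_gt0.
Qed.

Lemma tripod_block_eq_cases w w' :
  blk w = blk w' -> same_leg r leg w w' \/ r w < l /\ r w' < l.
Proof.
case=> e; rewrite -!div_eq0 e; case: ifP => [_ _|_ ww']; first by right.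
by left; rewrite /same_leg ww' eqxx !orbT.
Qed.

Let dist_center w : w \in T -> dist_le (linked R) (r w).+1 w p.
Proof.
move=> wT; have := tripod_dist T_tripod wT pT (same_leg_center w).1.
by rewrite rp distn0.
Qed.

Lemma tripod_block_diam : {in T &, forall w w', blk w = blk w' ->
  dist_le (linked R) (2 * l) w w'}.
Proof.
move=> w w' wT w'T e; case: (tripod_block_eq_cases e) => [ww'|[rw rw']].
  apply: dist_le_leq (tripod_dist T_tripod wT w'T ww').
  case: e => e _; have := divn_eq (r w) l; have := divn_eq (r w') l.
  have := ltn_pmod (r w) l_gt0; have := ltn_pmod (r w') l_gt0; rewrite e.
  by move: (_ %/ l * l) (r w %% l) (r w' %% l) => *; lia.
have d := dist_le_sym (linked_sym H g_sym R) (dist_center w'T).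
by apply: dist_le_leq (dist_le_trans (dist_center wT) d); lia.
Qed.

Lemma tripod_block_touch_leg w w' : w \in T -> w' \in T ->
  same_leg r leg w w' -> `|r w %/ l - r w' %/ l|%N <= 1 ->
  blk w = blk w' \/ exists x y,
    [/\ x \in T, y \in T, blk x = blk w, blk y = blk w' & g x y].
Proof.
move=> wT w'T ww' near; have [e|ne] := eqVneq (blk w) (blk w'); [by left | right].
have [||u [v [[uS vS /eqP bu bv] [guv _]]]] := @connect_induced_exit _ g _
    (fun z => blk z == blk w) _ _ (tripod_connect T_tripod wT w'T ww') => //.
  by rewrite eq_sym.
exists u, v; move: uS vS.
rewrite !inE => /andP[/andP[uT _] _] /andP[/andP[vT vS] /andP[vw vw']].
split=> //; have [lo hi] := andP vS.
have := leq_div2r l lo; have := leq_div2r l hi => {lo hi} hi lo.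
have : r v %/ l = r w %/ l \/ r v %/ l = r w' %/ l.
  by move: lo hi near; rewrite /minn /maxn; case: ifP => _; clear; lia.
by case=> e; [case/eqP: bv|]; apply: tripod_block_eq.
Qed.

Lemma tripod_block_touch : {in T &, forall w w' n, dist_le (linked R) n w w' -> n < l ->
  blk w = blk w' \/ exists x y,
    [/\ x \in T, y \in T, blk x = blk w, blk y = blk w' & g x y]}.
Proof.
move=> w w' wT w'T n d nl; have [ww'|nww'] := boolP (same_leg r leg w w').
  apply: tripod_block_touch_leg => //; apply: distn_div.
  exact: leq_ltn_trans (tripod_near T_tripod wT w'T ww' d) nl.
have [lo hi] := tripod_cross T_tripod wT w'T nww' d.
have div_le1 (x : nat) : x <= 2 * n -> x %/ l <= 1.
  by move=> x2; rewrite -ltnS ltn_divLR //; move: x2 nl; clear; lia.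
case: (leqP (r w) (r w')) lo hi => [_|_] lo /div_le1 hi.
  have e : blk w = blk p by apply: tripod_block_center; apply: leq_ltn_trans nl.
  have [|e'|[x [y xy]]] := tripod_block_touch_leg pT w'T (same_leg_center w').2.
  - by rewrite rp div0n dist0n.
  - by left; rewrite e.
  - by right; exists x, y; rewrite e.
have e : blk w' = blk p by apply: tripod_block_center; apply: leq_ltn_trans nl.
have [|e'|[x [y xy]]] := tripod_block_touch_leg wT pT (same_leg_center w).1.
- by rewrite rp div0n distn0.
- by left; rewrite e.
- by right; exists x, y; rewrite e.
Qed.

Lemma tripod_block_connect : {in T &, forall w w', blk w = blk w' ->
  connect (induced g [set x in T | blk x == blk w]) w w'}.
Proof.
have leg_connect w w' : w \in T -> w' \in T -> same_leg r leg w w' -> blk w = blk w' ->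
    connect (induced g [set x in T | blk x == blk w]) w w'.
  move=> wT w'T ww' e; apply: connect_induced_sub (tripod_connect T_tripod wT w'T ww').
  apply/subsetP => z; rewrite !inE => /andP[/andP[-> /andP[lo hi]] /andP[zw _]] /=.
  apply/eqP/tripod_block_eq => //; case: e => e _.
  have := leq_div2r l lo; have := leq_div2r l hi => {lo hi} hi lo.
  by move: lo hi e; rewrite /minn /maxn; case: ifP => _; clear; lia.
move=> w w' wT w'T e.
case: (tripod_block_eq_cases e) => [/leg_connect|[rw rw']]; first exact.
apply: connect_trans
  (leg_connect w p wT pT (same_leg_center w).1 (tripod_block_center rw)) _.
rewrite connect_induced_sym // e.
exact: leg_connect w' p w'T pT (same_leg_center w').1 (tripod_block_center rw').
Qed.

Lemma tripod_block_colour : {in T &, forall w w' n, odd (r w %/ l) = odd (r w' %/ l) ->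
  dist_le (linked R) n w w' -> n < l -> blk w = blk w'}.
Proof.
move=> w w' wT w'T n par d nl; have [ww'|nww'] := boolP (same_leg r leg w w').
  apply: tripod_block_eq => //.
  have := distn_div (leq_ltn_trans (tripod_near T_tripod wT w'T ww' d) nl).
  by move: (r w %/ l) (r w' %/ l) par => i j; clear; lia.
have [lo hi] := tripod_cross T_tripod wT w'T nww' d.
have both_small (x y : nat) :
    x <= n -> y <= 2 * n -> odd (x %/ l) = odd (y %/ l) -> x < l /\ y < l.
  move=> xn y2n; have xl := leq_ltn_trans xn nl.
  rewrite (divn_small xl) => par_y; split=> //.
  have : y %/ l < 2 by rewrite ltn_divLR //; move: y2n nl; clear; lia.
  by rewrite -div_eq0; case: (y %/ l) par_y => [|[]].
have [rw rw'] : r w < l /\ r w' < l.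
  case: (leqP (r w) (r w')) lo hi => [_|_] lo hi; first exact: both_small par.
  by apply/and_comm; apply: both_small (esym par).
by rewrite !tripod_block_center.
Qed.

End TripodCore.

Lemma tripod_core R T r leg p : tripod R T r leg p -> core R T.
Proof.
move=> T_tripod l l_gt0; exists (tripod_block r leg l), (fun w => odd (r w %/ l)).
split.
- exact: tripod_block_colour T_tripod l_gt0.
- exact: tripod_block_diam T_tripod l_gt0.
- exact: tripod_block_touch T_tripod l_gt0.
- exact: tripod_block_connect T_tripod l_gt0.
Qed.

Lemma tripod_connected R T r leg p : tripod R T r leg p -> connected_set g T.
Proof.
move=> T_tripod; have pT := tripod_center T_tripod.
split; first by apply/set0Pn; exists p.
have to_p w : w \in T -> connect (induced g T) w p.
  move=> wT; have wp : same_leg r leg w p.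
    by rewrite /same_leg (tripod_center0 T_tripod) eqxx orbT.
  apply: connect_induced_sub (tripod_connect T_tripod wT pT wp).
  by apply/subsetP => z; rewrite !inE => /andP[/andP[]].
move=> x y /to_p xp /to_p yp; apply: connect_trans xp _.
by rewrite connect_induced_sym.
Qed.

End Cores.

Section TripodExists.
Variables (V : finType) (g : rel V) (H : {set {set V}}).
Hypothesis g_sym : symmetric g.
Implicit Types (w z : V) (n : nat).
Local Notation linked := (linked g H).

Definition lipschitz (C : {set V}) (f : V -> nat) : Prop :=
  {in C &, forall w w' n, dist_le (linked C) n w w' -> `|f w - f w'|%N <= n}.

Section Union.
Variables (C P Q : {set V}) (f h : V -> nat) (a b c p : V).
Hypothesis P_thread : thread g H C f b a P.
Hypothesis Q_thread : thread g H C h c p Q.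
Hypothesis pP : p \in P.
Hypothesis h_P : {in P, forall w, h w = 0}.
Hypothesis f_lipschitz : lipschitz C f.
Hypothesis h_lipschitz : lipschitz C h.

Definition union_radius w : nat := if w \in P then `|f w - f p|%N else h w.
Definition union_leg w : nat := if w \in P then (f p < f w : nat) else 2.
Local Notation r := union_radius.
Local Notation same := (same_leg union_radius union_leg).
Local Notation leg_slice := (leg_slice union_radius union_leg (P :|: Q)).

Let PC w : w \in P -> w \in C. Proof. exact: subsetP (thread_sub P_thread) w. Qed.
Let QC w : w \in Q -> w \in C. Proof. exact: subsetP (thread_sub Q_thread) w. Qed.
Let pQ : p \in Q. Proof. exact: thread_end Q_thread. Qed.

Let r_P w : w \in P -> r w = `|f w - f p|%N. Proof. by rewrite /r => ->. Qed.

Let r_Q w : w \in Q -> r w = h w.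
Proof.
move=> wQ; rewrite /r; case: ifP => // wP; have hw := h_P wP.
by rewrite hw (thread_eq0 Q_thread wQ hw) distnn.
Qed.

Let r_p : r p = 0. Proof. by rewrite r_P // distnn. Qed.

Let same_sym : symmetric same.
Proof. by move=> w w'; rewrite /same_leg orbCA [union_leg w' == _]eq_sym. Qed.

Let same_PQ w w' : w \in P -> w' \in Q -> w' \notin P -> same w w' -> f w = f p.
Proof.
move=> wP w'Q w'P.
rewrite /same_leg (r_Q w'Q) r_P // distn_eq0 /union_leg wP (negPf w'P).
case/or3P=> [/eqP[]//|/eqP hw'|]; last by case: (f p < f w).
by rewrite (thread_eq0 Q_thread w'Q hw') pP in w'P.
Qed.

Let memU w : w \in P :|: Q -> w \in P \/ w \in Q /\ w \notin P.
Proof. by case/setUP => [|wQ]; [left | case: (boolP (w \in P)); [left | right]]. Qed.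

Let dist_PQ w w' n : w \in P -> w' \in Q -> dist_le (linked C) n w w' ->
  r w' <= n /\ r w <= 2 * n.
Proof.
move=> wP w'Q d; have := h_lipschitz (PC wP) (QC w'Q) d.
rewrite h_P // dist0n => hw'; rewrite (r_Q w'Q) (r_P wP); split=> //.
have := f_lipschitz (PC wP) (PC pP) (dist_le_trans d (thread_dist_end Q_thread w'Q)).
by move/leq_trans; apply; rewrite mul2n -addnn leq_add2l.
Qed.

Lemma union_near : {in P :|: Q &, forall w w' n, same w w' ->
  dist_le (linked C) n w w' -> `|r w - r w'|%N <= n}.
Proof.
have PQ w w' n : w \in P -> w' \in Q -> w' \notin P -> same w w' ->
    dist_le (linked C) n w w' -> `|r w - r w'|%N <= n.
  move=> wP w'Q w'P ww' d; have [rw' _] := dist_PQ wP w'Q d.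
  by rewrite (r_P wP) (same_PQ wP w'Q w'P ww') distnn dist0n.
move=> w w' /memU[wP|[wQ wP]] /memU[w'P|[w'Q w'P]] n ww' d.
- have := f_lipschitz (PC wP) (PC w'P) d; rewrite !r_P //.
  by move: (f w) (f w') (f p) => i j k; clear; lia.
- exact: PQ.
- by rewrite distnC; apply: PQ => //;
    [rewrite same_sym | apply: dist_le_sym (linked_sym H g_sym C) d].
- by rewrite !r_Q //; apply: h_lipschitz d; apply: QC.
Qed.

Lemma union_cross : {in P :|: Q &, forall w w' n, ~~ same w w' ->
  dist_le (linked C) n w w' -> minn (r w) (r w') <= n /\ maxn (r w) (r w') <= 2 * n}.
Proof.
have PQ w w' n : w \in P -> w' \in Q -> dist_le (linked C) n w w' ->
    minn (r w) (r w') <= n /\ maxn (r w) (r w') <= 2 * n.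
  move=> wP w'Q /(dist_PQ wP w'Q)[rw' rw]; rewrite geq_min rw' orbT geq_max rw.
  by rewrite mul2n -addnn (leq_trans rw') ?leq_addr.
move=> w w' /memU[wP|[wQ wP]] /memU[w'P|[w'Q w'P]] n ww' d.
- have := f_lipschitz (PC wP) (PC w'P) d; move: ww'.
  rewrite /same_leg /union_leg wP w'P !r_P //.
  by move: (f w) (f w') (f p) => i j k; clear; lia.
- exact: PQ.
- by rewrite minnC maxnC; apply: PQ => //; apply: dist_le_sym (linked_sym H g_sym C) d.
- by move: ww'; rewrite /same_leg /union_leg (negPf wP) (negPf w'P) eqxx !orbT.
Qed.

Lemma union_dist : {in P :|: Q &, forall w w', same w w' ->
  dist_le (linked C) `|r w - r w'|%N.+1 w w'}.
Proof.
have PQ w w' : w \in P -> w' \in Q -> w' \notin P -> same w w' ->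
    dist_le (linked C) `|r w - r w'|%N.+1 w w'.
  move=> wP w'Q w'P /(same_PQ wP w'Q w'P) fw.
  have d := dist_le_sym (linked_sym H g_sym C) (thread_dist_end Q_thread w'Q).
  have := dist_le_trans (thread_dist P_thread wP pP) d.
  by rewrite (r_P wP) fw distnn dist0n (r_Q w'Q).
move=> w w' /memU[wP|[wQ wP]] /memU[w'P|[w'Q w'P]] ww'.
- apply: dist_le_leq (thread_dist P_thread wP w'P); move: ww'.
  rewrite /same_leg /union_leg wP w'P !r_P //.
  by move: (f w) (f w') (f p) => i j k; clear; lia.
- exact: PQ.
- rewrite distnC; apply: dist_le_sym (linked_sym H g_sym C) _.
  by apply: PQ => //; rewrite same_sym.
- by rewrite !r_Q //; apply: thread_dist Q_thread _ _ wQ w'Q.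
Qed.

Lemma union_connect : {in P :|: Q &, forall w w', same w w' ->
  connect (induced g (leg_slice w w')) w w'}.
Proof.
have PP w w' : w \in P -> w' \in P -> same w w' ->
    connect (induced g (leg_slice w w')) w w'.
  move=> wP w'P ww'; apply: connect_induced_sub (thread_connect P_thread wP w'P).
  apply/subsetP => z; rewrite !inE => /andP[zP]; rewrite zP /=; move: ww'.
  rewrite /same_leg /union_leg wP w'P zP !r_P //.
  by move: (f w) (f w') (f p) (f z) => i j k m; clear; lia.
have QQ w w' : w \in Q -> w' \in Q -> (w == p) || (w \notin P) -> w' \notin P ->
    connect (induced g (leg_slice w w')) w w'.
  move=> wQ w'Q wP w'P; apply: connect_induced_sub (thread_connect Q_thread wQ w'Q).
  apply/subsetP => z; rewrite !inE => /andP[zQ]; rewrite zQ orbT !r_Q //= => -> /=.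
  rewrite /same_leg; case: (boolP (z \in P)) => zP; first by rewrite (r_Q zQ) (h_P zP).
  rewrite /union_leg (negPf zP) (negPf w'P) eqxx !orbT andbT.
  by case/orP: wP => [/eqP->|/negPf->]; rewrite ?r_p ?eqxx ?orbT.
have PQ w w' : w \in P -> w' \in Q -> w' \notin P -> same w w' ->
    connect (induced g (leg_slice w w')) w w'.
  move=> wP w'Q w'P ww'.
  have rw : r w = 0 by rewrite r_P // (same_PQ wP w'Q w'P ww') distnn.
  have wp : same w p by rewrite /same_leg rw eqxx.
  have pw' : same p w' by rewrite /same_leg r_p eqxx.
  apply: (@connect_trans _ _ p).
    apply: connect_induced_sub (PP _ _ wP pP wp); apply/subsetP => z.
    rewrite !inE rw r_p => /andP[/andP[-> +] /andP[-> _]].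
    by rewrite minnn maxnn /= leqn0 => /eqP rz; rewrite rz min0n /same_leg rz eqxx.
  apply: connect_induced_sub (QQ _ _ pQ w'Q _ w'P); last by rewrite eqxx.
  apply/subsetP => z; rewrite !inE rw r_p => /andP[/andP[-> ->] /andP[_ ->]].
  by rewrite /same_leg rw eqxx orbT.
move=> w w' /memU[wP|[wQ wP]] /memU[w'P|[w'Q w'P]] ww'.
- exact: PP.
- exact: PQ.
- rewrite same_sym in ww'; have := PQ w' w w'P wQ wP ww'.
  rewrite connect_induced_sym // /leg_slice sliceC; apply: connect_induced_sub.
  by apply/subsetP => z; rewrite !inE => /andP[-> /andP[-> ->]].
- by apply: QQ; rewrite ?wP ?orbT.
Qed.

Lemma union_tripod : tripod g H C (P :|: Q) union_radius union_leg p.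
Proof.
split; [by rewrite inE pP | exact: r_p | exact: union_near | exact: union_cross
  | exact: union_dist | exact: union_connect].
Qed.

End Union.

Hypothesis g_spans : spans g H.

Lemma core_exists C a b c : connected_set g C -> a \in C -> b \in C -> c \in C ->
  exists T : {set V}, [/\ T \subset C, a \in T, b \in T & c \in T] /\
    connected_set g T /\ core g H C T.
Proof.
move=> [_ C_conn] aC bC cC.
have C_reach (A : {set V}) z : A \subset C -> z \in A ->
    {in C, forall x, reachable (linked C) A x}.
  move=> sA zA x xC; exists z => //; apply: connect_linked => //.
  exact: C_conn (subsetP sA z zA) xC.
have lip (A : {set V}) z :
    A \subset C -> z \in A -> lipschitz C (dist_from (linked C) A).
  move=> sA zA w w' wC w'C n d; have reach := C_reach A z sA zA.
  have := dist_from_lipschitz (reach _ wC) d.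
  have := dist_from_lipschitz (reach _ w'C) (dist_le_sym (linked_sym H g_sym C) d).
  by move: (dist_from _ _ w) (dist_from _ _ w') => i j; clear; lia.
have sa : [set a] \subset C by rewrite sub1set.
have [P [a' [/set1P-> P_thread]]] :=
  thread_exists g_sym (C_reach _ _ sa (set11 a)) bC.
have sP := thread_sub P_thread; have aP := thread_end P_thread.
have [Q [p [pP Q_thread]]] := thread_exists g_sym (C_reach _ _ sP aP) cC.
have h_P : {in P, forall w, dist_from (linked C) P w = 0}.
  by move=> w wP; apply/eqP; rewrite dist_from_eq0.
have T_tripod := union_tripod P_thread Q_thread pP h_P
  (lip _ _ sa (set11 a)) (lip _ _ sP aP).
exists (P :|: Q); split; last first.
  by split; [exact: tripod_connected T_tripod | exact: tripod_core T_tripod].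
split; last by rewrite inE (thread_start Q_thread) orbT.
- by rewrite subUset sP (thread_sub Q_thread).
- by rewrite inE aP.
- by rewrite inE (thread_start P_thread).
Qed.

End TripodExists.

(** * Owners and absorption *)

(* The owner of [v] is identified by the region in which it was created, and [v]
   is attached to the vertex [anchor v] of its core. Both are irrelevant for the
   vertices of [free], which have no owner. *)
Record assignment (V : finType) := Assignment {
  free : {set V};
  region : V -> {set V};
  anchor : V -> V
}.

Section Assignments.
Variables (V : finType) (g : rel V).
Hypothesis g_sym : symmetric g.
Implicit Types (s : assignment V) (N R Y : {set V}) (q t u v w y z : V).

Definition owner s R : {set V} := [set v | (v \notin free s) && (region s v == R)].

Definition cores s R : {set V} := [set w in owner s R | anchor s w == w].

Definition fibre s t : {set V} := [set u | (u \notin free s) && (anchor s u == t)].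

Record owned s : Prop := Owned {
  mem_region : forall v, v \notin free s -> v \in region s v;
  anchor_not_free : forall v, v \notin free s -> anchor s v \notin free s;
  region_anchor : forall v, v \notin free s -> region s (anchor s v) = region s v;
  anchor_id : forall v, v \notin free s -> anchor s (anchor s v) = anchor s v;
  connect_anchor : forall v, v \notin free s ->
    connect (induced g (fibre s (anchor s v))) v (anchor s v)
}.

Lemma ownerP s R v : reflect (v \notin free s /\ region s v = R) (v \in owner s R).
Proof. by rewrite inE; apply: (iffP andP) => -[v_owned /eqP]. Qed.

Lemma mem_owner s v : v \notin free s -> v \in owner s (region s v).
Proof. by move=> v_owned; apply/ownerP. Qed.

Lemma anchor_core s v : owned s -> v \notin free s ->
  anchor s v \in cores s (region s v).
Proof.
move=> s_owned v_owned.
by rewrite !inE anchor_not_free // region_anchor // anchor_id // !eqxx.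
Qed.

Lemma owner_connected s R : owned s ->
  connected_set g (cores s R) -> connected_set g (owner s R).
Proof.
move=> s_owned [/set0Pn[t tR] cores_conn]; split.
  by apply/set0Pn; exists t; move: tR; rewrite inE => /andP[].
have sub_cores : cores s R \subset owner s R.
  by apply/subsetP => w; rewrite inE => /andP[].
have to_core v : v \in owner s R ->
    connect (induced g (owner s R)) v (anchor s v) /\ anchor s v \in cores s R.
  rewrite inE => /andP[v_owned /eqP <-]; split; last exact: anchor_core.
  apply: connect_induced_sub (connect_anchor s_owned v_owned).
  apply/subsetP => w; rewrite !inE => /andP[w_owned /eqP wv]; rewrite w_owned.
  by rewrite -(region_anchor s_owned w_owned) wv region_anchor /=.
move=> x y /to_core[xx' x'R] /to_core[yy' y'R]; apply: connect_trans xx' _.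
apply: connect_trans (connect_induced_sub sub_cores (cores_conn _ _ x'R y'R)) _.
by rewrite connect_induced_sym.
Qed.

Definition extends s s' : Prop := free s' \subset free s /\
  forall v, v \notin free s -> region s' v = region s v /\ anchor s' v = anchor s v.

Lemma extends_refl s : extends s s. Proof. by []. Qed.

Lemma extends_free s s' v : extends s s' -> v \notin free s -> v \notin free s'.
Proof. by case=> sub _; apply: contra => /(subsetP sub). Qed.

Lemma extends_trans s1 s2 s3 : extends s1 s2 -> extends s2 s3 -> extends s1 s3.
Proof.
move=> s12 s23; split=> [|v v1]; first exact: subset_trans s23.1 s12.1.
by have [-> ->] := s23.2 v (extends_free s12 v1); apply: s12.2.
Qed.

Definition borders N v y : bool := [exists q in N, g q y && connect (induced g N) v q].

Section Absorb.
Variables (s : assignment V) (N Y : {set V}).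
Hypothesis s_owned : owned s.
Hypothesis N_free : N \subset free s.
Hypothesis Y_owned : {in Y, forall y, y \notin free s}.
Hypothesis Y_region : {in Y, forall y, N \subset region s y}.
Hypothesis Y_borders : {in N, forall v, exists2 y, y \in Y & borders N v y}.

Definition host v : V := if v \in N then odflt v [pick y in Y | borders N v y] else v.

Definition absorb : assignment V :=
  Assignment (free s :\: N) (region s \o host) (anchor s \o host).

Lemma hostN v : v \notin N -> host v = v.
Proof. by rewrite /host => /negPf ->. Qed.

Lemma hostP v : v \in N -> host v \in Y /\ borders N v (host v).
Proof.
move=> vN; rewrite /host vN; case: pickP => [y /andP[]//|/= none].
by have [y yY vy] := Y_borders vN; move: (none y); rewrite yY vy.
Qed.

Lemma host_connect v w : v \in N -> connect (induced g N) v w -> host v = host w.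
Proof.
move=> vN vw; have wN := connect_induced_mem vN vw; have [wY _] := hostP wN.
move: wY; rewrite /host vN wN.
have -> : [pick y in Y | borders N v y] = [pick y in Y | borders N w y].
  apply: eq_pick => y; congr (_ && _); apply: eq_existsb => q; congr [&& _, _ & _].
  by rewrite (same_connect (connect_induced_sym g_sym N) vw).
by case: pickP => //= _ wY; move: (Y_owned wY); rewrite (subsetP N_free).
Qed.

Let host_owned v : v \notin free absorb -> host v \notin free s.
Proof.
rewrite inE negb_and negbK => /orP[/hostP[/Y_owned]//|v_owned].
by rewrite hostN //; apply: contra v_owned; apply: subsetP N_free v.
Qed.

Let host_not_free v : v \notin free s -> host v = v.
Proof.
by move=> v_owned; apply: hostN; apply: contra v_owned; apply: subsetP N_free v.
Qed.

Lemma absorb_extends : extends s absorb.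
Proof.
split=> [|v v_owned]; first exact: subsetDl.
by rewrite /= host_not_free.
Qed.

Let host_anchor v : v \notin free absorb -> host (anchor absorb v) = anchor absorb v.
Proof. by move=> /host_owned v_owned; apply: host_not_free; apply: anchor_not_free. Qed.

Lemma absorb_owned : owned absorb.
Proof.
split=> v v_owned; have hv := host_owned v_owned.
- case: (boolP (v \in N)) => vN; first exact: (subsetP (Y_region (hostP vN).1)).
  by rewrite (hostN vN) in hv; rewrite /= hostN // mem_region.
- exact: extends_free absorb_extends (anchor_not_free s_owned hv).
- by rewrite [LHS]/= host_anchor //; apply: region_anchor.
- by rewrite [LHS]/= host_anchor //; apply: anchor_id.
have sub_fibre : fibre s (anchor absorb v) \subset fibre absorb (anchor absorb v).
  apply/subsetP => w; rewrite !inE => /andP[w_owned /eqP wv].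
  by rewrite (negPf w_owned) andbF /= host_not_free // wv eqxx.
apply: connect_trans (connect_induced_sub sub_fibre (connect_anchor s_owned hv)).
case: (boolP (v \in N)) => vN; last by rewrite (hostN vN) connect0.
have [_ /exists_inP[q qN /andP[qv vq]]] := hostP vN.
have mem_fibre w : w \in component g N v -> w \in fibre absorb (anchor absorb v).
  by rewrite !inE => /andP[wN vw]; rewrite wN /= (host_connect vN vw) eqxx.
apply: (@connect_trans _ _ q).
  apply: connect_induced_sub (connect_component vN vq).
  by apply/subsetP => w /mem_fibre.
apply: connect_induced1 qv; first by apply: mem_fibre; rewrite inE qN.
by apply: (subsetP sub_fibre); rewrite inE hv eqxx.
Qed.

End Absorb.

End Assignments.

Section Fringe.
Variables (V : finType) (g : rel V) (H : {set {set V}}).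
Hypothesis g_sym : symmetric g.
Hypothesis g_spans : spans g H.
Implicit Types (C N R T U Y : {set V}) (k q t v y z : V).
Local Notation linked := (linked g H).

Definition fringe C Y : {set V} :=
  [set v in C | [exists k in C, exists y in Y, linked C v k && g k y]].

Lemma fringeP C Y v : reflect
  (v \in C /\ exists k y, [/\ k \in C, y \in Y, linked C v k & g k y])
    (v \in fringe C Y).
Proof.
rewrite inE; apply: (iffP andP) => -[vC].
  case/exists_inP=> k kC /exists_inP[y yY /andP[vk ky]].
  by split=> //; exists k, y.
case=> k [y [kC yY vk ky]]; split=> //; apply/exists_inP; exists k => //.
by apply/exists_inP; exists y; rewrite ?vk.
Qed.

Lemma fringe_borders C Y U : {in fringe C Y :&: U, forall v,
  exists2 y, y \in Y :|: (C :\: U) & borders g (fringe C Y :&: U) v y}.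
Proof.
set N := _ :&: U => v vN; have [/fringeP[vC [k [y [kC yY vk ky]]]] vU] := setIP vN.
have yY' : y \in Y :|: (C :\: U) by rewrite inE yY.
case/orP: (vk) => [/eqP vE|/exists_inP[A AH /and3P[vA kA vk_piece]]].
  by exists y => //; apply/exists_inP; exists v; rewrite // connect0 {1}vE ky.
have [vk_N|nvk] := boolP (connect (induced g ((A :&: C) :&: N)) v k).
  have kN : k \in N.
    apply: (subsetP (subsetIr (A :&: C) N)).
    by apply: connect_induced_mem vk_N; apply/setIP.
  exists y => //; apply/exists_inP; exists k; rewrite // ky.
  exact: connect_induced_sub (subsetIr _ _) vk_N.
have [||u [w [[uA wA vu nvw] [uw _]]]] := @connect_induced_exit _ g _
  (fun z => connect (induced g ((A :&: C) :&: N)) v z) _ _ vk_piece => //.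
have uN : u \in (A :&: C) :&: N by apply: connect_induced_mem vu; rewrite inE vA.
have wC : w \in C by case/setIP: wA.
exists w; last first.
  apply/exists_inP; exists u; first by case/setIP: uN.
  by rewrite uw; apply: connect_induced_sub vu; apply: subsetIr.
rewrite !inE wC andbT; apply/orP; right; apply: contra nvw => wU.
apply: (connect_trans vu); apply: connect_induced1 => //.
apply/setIP; split=> //; apply/setIP; split=> //; apply/fringeP; split=> //.
exists k, y; split=> //.
apply: (linked_connected AH (subsetIl _ _) (subsetIr _ _) wA).
apply: connect_trans vk_piece; rewrite connect_induced_sym //.
apply: connect_trans (connect_induced_sub (subsetIl _ _) vu) _.
exact: connect_induced1.
Qed.

(* Along a component of [N], consecutive vertices are near core vertices of one
   colour at distance less than [l], so that all of these lie in one block. *)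
Lemma near_colour_diam R T N l blk col c rho v q :
  block_system g H R T l blk col -> 2 * rho + 1 < l -> N \subset R ->
  {in N, forall z, exists t, [/\ t \in T, col t = c & dist_le (linked R) rho z t]} ->
  v \in N -> connect (induced g N) v q -> dist_le (linked R) (2 * rho + 2 * l) v q.
Proof.
move=> blocks rho_l sNR near_T vN /connectP[p pp ->].
have d_sym := dist_le_sym (linked_sym H g_sym R).
have [t [tT ct vt]] := near_T v vN.
suff [t' [[t'T ct' b't] qt']] : exists t',
    [/\ t' \in T, col t' = c & blk t' = blk t] /\ dist_le (linked R) rho (last v p) t'.
  have tt' := block_diam blocks tT t'T (esym b't).
  apply: dist_le_leq (dist_le_trans (dist_le_trans vt tt') (d_sym _ _ _ qt')).
  by clear; lia.
elim/last_ind: p pp => [_|p z IHp]; first by exists t.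
rewrite rcons_path last_rcons => /andP[/IHp[t' [[t'T ct' b't] lt']] /and3P[lN zN lz]].
have [w [wT cw zw]] := near_T z zN; exists w; split=> //; split=> //; rewrite -b't.
have lz1 := dist_le1 (linked_edge g_spans (subsetP sNR _ lN) (subsetP sNR _ zN) lz).
apply: esym; apply: (block_colour blocks t'T wT); first by rewrite ct' cw.
  exact: dist_le_trans (dist_le_trans (d_sym _ _ _ lt') lz1) zw.
by apply: leq_ltn_trans rho_l; clear; lia.
Qed.

End Fringe.

(** * Stages of the construction *)

Section Touch.
Variables (V : finType) (g : rel V).
Implicit Types (A B : {set V}).

Lemma touchP A B : reflect (exists x y, [/\ x \in A, y \in B & g x y]) (touch g A B).
Proof.
apply: (iffP exists_inP) => [[x xA /exists_inP[y yB xy]]|[x [y [xA yB xy]]]].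
  by exists x, y.
by exists x => //; apply/exists_inP; exists y.
Qed.

Lemma touch_sym : symmetric g -> symmetric (touch g).
Proof.
move=> g_sym A B; apply/touchP/touchP => -[x [y [xA yB xy]]];
  by exists y, x; rewrite g_sym.
Qed.

End Touch.

Definition clique_minor (V : finType) (g : rel V) (n : nat) : Prop :=
  exists F : seq {set V}, [/\ size F = n, forall A, A \in F -> connected_set g A &
    pairwise (fun A B : {set V} => [disjoint A & B] && touch g A B) F].

Lemma clique_minor_branches (V : finType) (g : rel V) n : clique_minor g n.+1 ->
  exists (B : nat -> {set V}) (c : nat -> V),
  [/\ forall i, i < n.+1 -> c i \in B i,
      forall i j, i < j < n.+1 -> [disjoint B i & B j] &
      forall i j, i < j < n.+1 -> connect (induced g (B i :|: B j)) (c i) (c j)].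
Proof.
case=> F [F_size F_conn F_pair]; pose B i := nth set0 F i.
have B_conn i : i < n.+1 -> connected_set g (B i).
  by move=> i_lt; apply: F_conn; rewrite mem_nth ?F_size.
have B_pair i j : i < j < n.+1 -> [disjoint B i & B j] /\ touch g (B i) (B j).
  case/andP=> ij j_lt; apply/andP; have := pairwiseP set0 F_pair i j.
  by rewrite !inE F_size (ltn_trans ij j_lt) j_lt; apply.
have c_exists (i : 'I_n.+1) : exists x, x \in B i.
  by have [/set0Pn] := B_conn i (ltn_ord i).
have [c cB] := fin_all_exists c_exists.
have cB' i : i < n.+1 -> c (inord i) \in B i by move=> i_lt; rewrite -{2}(inordK i_lt).
exists B, (c \o inord); split=> [//|i j /B_pair[]//|i j ij /=].
have [/andP[ij_lt j_lt] [_ /touchP[x [y [xB yB xy]]]]] := (ij, B_pair i j ij).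
have i_lt := ltn_trans ij_lt j_lt; apply: (connect_trans (y := x)).
  by apply: connect_induced_sub (subsetUl _ _) ((B_conn i i_lt).2 _ _ (cB' i i_lt) xB).
apply: (connect_trans (y := y)).
  by apply: connect_induced1; rewrite ?inE ?xB ?yB ?orbT.
by apply: connect_induced_sub (subsetUr _ _) ((B_conn j j_lt).2 _ _ yB (cB' j j_lt)).
Qed.

Section Depth.
Variable V : finType.
Implicit Types (S : {set {set V}}) (R X Y : {set V}).

Definition nested R X : bool := (R \subset X) || (X \subset R).

Lemma nestedC R X : nested R X = nested X R.
Proof. exact: orbC. Qed.

(* An owner is older than another one if its region is larger. *)
Definition depth S R : nat := #|[set Y in S | R \proper Y]|.

Lemma depth_sub S S' R : S \subset S' -> depth S R <= depth S' R.
Proof.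
move=> /subsetP sub; apply: subset_leq_card; apply/subsetP => Y.
by rewrite !inE => /andP[/sub -> ->].
Qed.

Lemma depth_lt_card S R : R \in S -> depth S R < #|S|.
Proof.
move=> RS; apply: proper_card; apply/properP; split.
  by apply/subsetP => Y; rewrite inE => /andP[].
by exists R => //; rewrite inE properxx andbF.
Qed.

Lemma depth_lt S R X : R \in S -> X \proper R -> depth S R < depth S X.
Proof.
move=> RS XR; apply: proper_card; apply/properP; split.
  by apply/subsetP => Y; rewrite !inE => /andP[-> /=]; apply: proper_trans.
by exists R; rewrite !inE ?RS // properxx andbF.
Qed.

Lemma depth_subset S R X : R \in S -> nested R X ->
  depth S X <= depth S R -> R \subset X.
Proof.
move=> RS RX_nested le_d; apply: contraT => nRX.
have XR : X \proper R by move: RX_nested; rewrite /nested properE (negPf nRX) /= => ->.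
by move: (depth_lt RS XR); rewrite ltnNge le_d.
Qed.

Lemma depth_inj S R X : R \in S -> X \in S -> nested R X ->
  depth S R = depth S X -> R = X.
Proof.
move=> RS XS RX_nested e; apply/eqP; rewrite eqEsubset.
by rewrite (depth_subset RS) ?e // (depth_subset XS) ?e // nestedC.
Qed.

End Depth.

(* An owner with [p] older ones in the bag of a component keeps its boundary
   vertices at distance at most [radius p] from their anchors. When a cut off
   owner leaves the bag, [p] drops and the owner may absorb again, whence
   [radius p.+1 + \sum_(p < q < 4) 2 * (6 * radius q + 17) <= radius p]. *)
Definition radius (p : nat) : nat :=
  match p with 0 => 8400 | 1 => 600 | 2 => 40 | _ => 0 end.

Definition absorption_cost (p : nat) : nat := 6 * radius p + 17.

Lemma radius_antitone p q : p <= q -> radius q <= radius p.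
Proof. by case: p q => [|[|[|p]]] [|[|[|q]]]. Qed.

Section Stage.
Variables (V : finType) (g : rel V) (H : {set {set V}}).
Implicit Types (A K R X Y : {set V}) (u v w x y : V).
Implicit Types (s : assignment V) (b : V -> {set {set V}}).
Local Notation linked := (linked g H).

Definition in_member K : bool := [exists A in H, K \subset A].

Definition may_own s b x R : bool :=
  if x \in free s then R \in b x else region s x == R.

(* [R] may become the oldest owner of the vertices of [K]. *)
Definition oldest_owner s b K R : Prop :=
  [/\ K \subset R,
      {in K, forall x, x \notin free s -> region s x \subset R} &
      exists2 x, x \in K & may_own s b x R].

(* The bag of a free vertex contains the owners around its component. *)
Record stage s b : Prop := Stage {
  stage_owned : owned g s;
  stage_radius : forall v, v \notin free s ->
    dist_le (linked (region s v)) (radius 0) v (anchor s v);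
  stage_core : forall v, v \notin free s ->
    core g H (region s v) (cores s (region s v)) /\
    connected_set g (cores s (region s v));
  bag_region : forall u R, u \in free s -> R \in b u ->
    component g (free s) u \subset R;
  bag_owner : forall u R, u \in free s -> R \in b u -> owner s R != set0;
  bag_card : forall u, u \in free s -> #|b u| <= 4;
  bag_edge : forall u v, u \in free s -> v \in free s -> g u v -> b u = b v;
  boundary_bag : forall u v, u \in free s -> v \notin free s -> g u v ->
    region s v \in b u;
  boundary_radius : forall u v, u \in free s -> v \notin free s -> g u v ->
    dist_le (linked (region s v)) (radius (depth (b u) (region s v))) v (anchor s v);
  bag_oldest : forall u K R, u \in free s -> connected_set g K -> in_member K ->
    u \in K -> ~~ (K \subset component g (free s) u) ->
      oldest_owner s b K R -> R \in b u;
  bag_touch : forall u R X, u \in free s -> R \in b u -> X \in b u -> R != X ->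
    touch g (owner s R) (owner s X);
  region_laminar : forall v w, v \notin free s -> w \notin free s ->
    [disjoint region s v & region s w] || nested (region s v) (region s w);
  region_edge : forall v w, v \notin free s -> w \notin free s -> g v w ->
    nested (region s v) (region s w);
  region_component : forall v u, v \notin free s -> u \in free s -> u \in region s v ->
    component g (free s) u \subset region s v
}.

(* Lexicographic in the number of free vertices and the total size of their bags. *)
Definition weight s b : nat := #|free s| * (4 * #|V|).+1 + \sum_(u in free s) #|b u|.

Lemma weight_lt s b s' b' :
  stage s' b' -> #|free s'| < #|free s| -> weight s' b' < weight s b.
Proof.
move=> s'_stage lt_free; apply: leq_trans (leq_addr _ _).
apply: leq_trans (leq_mul lt_free (leqnn _)).
rewrite /weight [X in _ < X]mulSn addnC ltn_add2r ltnS.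
apply: (@leq_trans (\sum_(u in free s') 4)).
  by apply: leq_sum => u; apply: (bag_card s'_stage).
by rewrite sum_nat_const mulnC leq_mul2l max_card.
Qed.

Hypothesis g_sym : symmetric g.

Section Bag.
Variables (s : assignment V) (b : V -> {set {set V}}) (u0 : V).
Hypothesis s_stage : stage s b.
Hypothesis u0_free : u0 \in free s.
Local Notation C := (component g (free s) u0).
Local Notation B := (b u0).

Lemma component_free x : x \in C -> x \in free s.
Proof. exact: (subsetP (component_sub g (free s) u0)). Qed.

Lemma bag_component x : x \in C -> b x = B.
Proof.
rewrite inE => /andP[_ /connectP[p pp ->]].
elim: p u0 u0_free pp => //= z p IHp y y_free.
by case/andP=> /and3P[_ z_free yz] /(IHp z z_free)->;
  rewrite (bag_edge s_stage y_free z_free yz).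
Qed.

Lemma component_bag R : R \in B -> C \subset R.
Proof. exact: (bag_region s_stage u0_free). Qed.

Lemma bag_ownerP R : R \in B -> exists2 v, v \notin free s & region s v = R.
Proof.
by case/(bag_owner s_stage u0_free)/set0Pn => v /ownerP[? ?]; exists v.
Qed.

Lemma bag_nested R X : R \in B -> X \in B -> nested R X.
Proof.
move=> RB XB; have [[v v_owned vR] [w w_owned wX]] := (bag_ownerP RB, bag_ownerP XB).
have := region_laminar s_stage v_owned w_owned.
rewrite vR wX => /orP[RX|//].
have u0C := mem_component g u0_free.
by move: (disjointFr RX (subsetP (component_bag RB) _ u0C));
  rewrite (subsetP (component_bag XB)).
Qed.

Lemma bag_depth R : R \in B -> depth B R < 4.
Proof. by move/depth_lt_card/leq_trans; apply; apply: (bag_card s_stage). Qed.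

Lemma boundary_anchor R k y : k \in C -> y \in owner s R -> g k y ->
  [/\ R \in B, y \in R, anchor s y \in cores s R &
      dist_le (linked R) (radius (depth B R)) y (anchor s y)].
Proof.
move=> kC /ownerP[y_owned <-] ky.
have k_free := component_free kC; rewrite -(bag_component kC).
split; [exact: (boundary_bag s_stage k_free) | | | exact: (boundary_radius s_stage)].
  exact: (mem_region (stage_owned s_stage)).
exact: (anchor_core (stage_owned s_stage)).
Qed.

Definition abutting : {set {set V}} := [set R | touch g C (owner s R)].

Lemma abutting_bag : abutting \subset B.
Proof.
apply/subsetP => R; rewrite inE => /touchP[k [y [kC yR ky]]].
by have [] := boundary_anchor kC yR ky.
Qed.

(* [P] is the bag that the component inherits: the old one, or the old one
   together with the new owner [C]. *)
Definition palette (P : {set {set V}}) : Prop :=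
  [/\ B \subset P, P \subset C |: B & #|P| <= 4].

Record step (P : {set {set V}}) s' (b' : V -> {set {set V}}) : Prop := Step {
  step_stage : stage s' b';
  step_palette : palette P;
  step_extends : extends s s';
  step_new : forall v, v \in free s -> v \notin free s' -> v \in C /\ region s' v \in P;
  step_bag : forall u, u \in free s' -> b' u \subset (if u \in C then P else b u)
}.

End Bag.
End Stage.

Section Shave.
Variables (V : finType) (g : rel V) (H : {set {set V}}).
Hypothesis g_sym : symmetric g.
Hypothesis g_spans : spans g H.
Variables (s : assignment V) (b : V -> {set {set V}}) (u0 : V).
Hypothesis s_stage : stage g H s b.
Hypothesis u0_free : u0 \in free s.
Implicit Types (R X Y K : {set V}) (u v w x y : V) (p q : nat).
Local Notation linked := (linked g H).
Local Notation C := (component g (free s) u0).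
Local Notation B := (b u0).
Local Notation abutting := (abutting g s u0).

(* The owners around [C] that are younger than some owner cut off from [C]. *)
Definition targets : {set {set V}} :=
  [set R in abutting | [exists X in B :\: abutting, R \proper X]].

Definition near R : {set V} := fringe g H C (owner s R).

Lemma target_abutting R : R \in targets -> R \in abutting.
Proof. by rewrite inE => /andP[]. Qed.

Lemma target_bag R : R \in targets -> R \in B.
Proof. by move/target_abutting; apply/subsetP/(abutting_bag s_stage u0_free). Qed.

Lemma target_depth R : R \in targets -> depth abutting R < depth B R.
Proof.
rewrite inE => /andP[RA /exists_inP[X /setDP[XB XA] RX]]; apply: proper_card.
apply/properP; split; last first.
  by exists X; rewrite !inE ?XB ?RX // in XA *; rewrite (negPf XA).
apply/subsetP => Y; rewrite in_set => /andP[YA RY]; rewrite in_set RY andbT.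
by apply: subsetP YA; apply: (abutting_bag s_stage u0_free).
Qed.

Definition absorption_bound R p : nat :=
  radius (depth B R) + \sum_(depth B R <= q < p) 2 * absorption_cost q.

Lemma absorption_boundS R p : depth B R <= p ->
  absorption_bound R p.+1 = absorption_bound R p + 2 * absorption_cost p.
Proof. by move=> dp; rewrite /absorption_bound big_nat_recr //= addnA. Qed.

Lemma absorption_bound_leqS R p : absorption_bound R p <= absorption_bound R p.+1.
Proof.
case: (leqP (depth B R) p) => [/absorption_boundS->|dp]; first exact: leq_addr.
by rewrite /absorption_bound !big_geq // ltnW.
Qed.

Lemma absorption_bound_radius R :
  R \in targets -> absorption_bound R 4 <= radius (depth abutting R).
Proof.
move=> Rt; have dR := target_depth Rt.
have d4 := bag_depth s_stage u0_free (target_bag Rt).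
apply: (@leq_trans (radius (depth B R).-1)); last first.
  by apply: radius_antitone; rewrite -ltnS prednK //; apply: leq_trans dR.
rewrite /absorption_bound; case: (depth B R) dR d4 => [|[|[|[|//]]]] //= _ _;
  by rewrite /index_iota /= !big_cons big_nil.
Qed.

(* [s'] arises from [s] by absorptions into targets of depth below [p], with
   new vertices of [R] at distance at most [h R] from their anchors. *)
Record shaved (h : {set V} -> nat) p s' : Prop := Shaved {
  shaved_owned : owned g s';
  shaved_extends : extends s s';
  shaved_new : forall v, v \in free s -> v \notin free s' ->
    [/\ v \in C, region s' v \in targets & depth B (region s' v) < p] /\
    [/\ anchor s' v \notin free s &
        dist_le (linked (region s' v)) (h (region s' v)) v (anchor s' v)]
}.

Lemma shaved_leq h h' p p' s' :
  {in targets, forall R, depth B R < p -> h R <= h' R} -> p <= p' ->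
  shaved h p s' -> shaved h' p' s'.
Proof.
move=> hh' pp' [s'_owned ss' new]; split=> // v v_free v_s'.
have [[vC vt vp] [va vd]] := new v v_free v_s'; split; split=> //.
  exact: leq_trans pp'.
exact: dist_le_leq (hh' _ vt vp) vd.
Qed.

Section Pass.
Variables (R : {set V}) (p : nat) (blk : V -> nat * nat) (col : V -> bool).
Hypothesis R_target : R \in targets.
Hypothesis R_depth : depth B R = p.
Hypothesis R_blocks : block_system g H R (cores s R) (2 * radius p + 6) blk col.

Definition colour_class c : {set V} := [set y in owner s R | col (anchor s y) == c].

Variables (h : {set V} -> nat) (c : bool) (s1 : assignment V).
Hypothesis h_R : radius p <= h R.
Hypothesis s1_shaved : shaved h p.+1 s1.

Let N : {set V} := fringe g H C (colour_class c) :&: free s1.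
Let Y : {set V} := owner s R :|: (free s :\: free s1).
Let RB : R \in B. Proof. exact: target_bag. Qed.
Let CR : C \subset R. Proof. exact: (component_bag s_stage u0_free RB). Qed.

Let fringe_C v : v \in fringe g H C (colour_class c) -> v \in C.
Proof. by case/fringeP. Qed.

Let NC : N \subset C.
Proof. by apply/subsetP => v /setIP[/fringe_C]. Qed.

Let region_s1 v : v \notin free s ->
  region s1 v = region s v /\ anchor s1 v = anchor s v.
Proof. exact: (shaved_extends s1_shaved).2. Qed.

Let new_region y : y \in free s :\: free s1 -> R \subset region s1 y.
Proof.
case/setDP=> y_free y_s1; have [[_ yt yp] _] := shaved_new s1_shaved y_free y_s1.
apply: (depth_subset RB); last by rewrite R_depth -ltnS.
exact: (bag_nested s_stage u0_free RB (target_bag yt)).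
Qed.

Let Y_owned : {in Y, forall y, y \notin free s1}.
Proof.
move=> y /setUP[/ownerP[y_owned _]|/setDP[]//].
exact: (extends_free (shaved_extends s1_shaved) y_owned).
Qed.

Let Y_region : {in Y, forall y, R \subset region s1 y}.
Proof.
move=> y /setUP[/ownerP[y_owned <-]|/new_region//].
by have [-> _] := region_s1 y_owned.
Qed.

Let Y_borders : {in N, forall v, exists2 y, y \in Y & borders g N v y}.
Proof.
move=> v vN; have [y yY vy] := fringe_borders g_sym vN; exists y => //.
move: yY; rewrite !inE => /orP[/andP[->//]|/andP[-> yC]].
by rewrite (component_free (_ : y \in C)) ?orbT // inE.
Qed.

Let N_anchor : {in N, forall z, exists t,
  [/\ t \in cores s R, col t = c & dist_le (linked R) (radius p + 2) z t]}.
Proof.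
move=> z /setIP[/fringeP[zC [k [y [kC yc zk ky]]]] _].
move: yc; rewrite inE => /andP[yR /eqP cy].
have [_ yR' tR yt] := boundary_anchor s_stage u0_free kC yR ky; rewrite R_depth in yt.
exists (anchor s y); split=> //; rewrite addnC.
apply: dist_le_trans yt; apply: (@dist_le_trans _ _ 1 1 z k y); apply: dist_le1.
  exact: (linked_sub CR).
by apply: linked_edge => //; apply: (subsetP CR).
Qed.

Let N_dist v (q : V) : v \in N -> connect (induced g N) v q ->
  dist_le (linked R) (6 * radius p + 16) v q.
Proof.
move=> vN vq; have NR : N \subset R := subset_trans NC CR.
apply: dist_le_leq (near_colour_diam g_sym g_spans R_blocks _ NR N_anchor vN vq);
  by move: (radius p) => r; clear; lia.
Qed.

Let host_dist v : v \in N ->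
  let y := host g N Y v in
  [/\ region s1 y \in targets, depth B (region s1 y) < p.+1, anchor s1 y \notin free s &
      dist_le (linked (region s1 y)) (h (region s1 y) + absorption_cost p)
        v (anchor s1 y)].
Proof.
move=> vN y; have [yY /exists_inP[q qN /andP[qy vq]]] := hostP Y_borders vN.
rewrite -/y in yY qy; have qC := subsetP NC q qN; have vq_dist := N_dist vN vq.
case/setUP: (yY) => [yR|/[dup]/new_region Ry /setDP[y_free y_s1]].
  have [_ yR' tR yt] := boundary_anchor s_stage u0_free qC yR qy; rewrite R_depth in yt.
  have [y_owned Ry] := ownerP _ _ _ yR; have [-> ->] := region_s1 y_owned.
  rewrite Ry R_depth ltnSn; split=> //.
    exact: (anchor_not_free (stage_owned s_stage)).
  have qy1 := dist_le1 (linked_edge g_spans (subsetP CR q qC) yR' qy).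
  apply: dist_le_leq (dist_le_trans (dist_le_trans vq_dist qy1) yt).
  by move: h_R; rewrite /absorption_cost; move: (radius p) => r; clear; lia.
have [[yC yt yp] [ya yd]] := shaved_new s1_shaved y_free y_s1; split=> //.
have y_region : y \in region s1 y by apply: (mem_region (shaved_owned s1_shaved)).
have qy1 := dist_le1 (linked_edge g_spans (subsetP Ry _ (subsetP CR q qC)) y_region qy).
have vq' := dist_le_sub (linked_sub Ry) vq_dist.
apply: dist_le_leq (dist_le_trans (dist_le_trans vq' qy1) yd).
by rewrite /absorption_cost; move: (radius p) => r; clear; lia.
Qed.

Lemma colour_pass : exists s2,
  [/\ shaved (fun X => h X + absorption_cost p) p.+1 s2, free s2 \subset free s1 &
      [disjoint free s2 & fringe g H C (colour_class c)]].
Proof.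
have N_free : N \subset free s1 by apply: subsetIr.
have N_region : {in Y, forall y, N \subset region s1 y}.
  by move=> y /Y_region; apply: subset_trans; apply: subset_trans NC CR.
exists (absorb g s1 N Y); split; last 2 first.
- exact: subsetDl.
- apply/pred0P => v /=; apply/negP => /andP[/setDP[v_s1 vN] v_fringe].
  by case/negP: vN; apply/setIP.
have s12 := absorb_extends g Y N_free; have s1_owned := shaved_owned s1_shaved.
split; [exact: absorb_owned | exact: (extends_trans (shaved_extends s1_shaved) s12) |].
move=> v v_free; rewrite inE negb_and negbK.
have [v_s1|v_s1 _] := boolP (v \in free s1).
  rewrite orbF => vN; have [yt yp ya vd] := host_dist vN; split; split=> //.
  exact: (subsetP NC).
have [-> ->] := s12.2 v v_s1; have [new [va vd]] := shaved_new s1_shaved v_free v_s1.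
by split=> //; split=> //; apply: dist_le_leq vd; apply: leq_addr.
Qed.

End Pass.

Lemma shave_target p s1 R : R \in targets -> depth B R = p ->
  shaved (absorption_bound^~ p) p.+1 s1 ->
  exists s2, [/\ shaved (absorption_bound^~ p.+1) p.+1 s2, free s2 \subset free s1 &
    [disjoint free s2 & near R]].
Proof.
move=> Rt Rp s1_shaved.
have [v v_owned vR] := bag_ownerP s_stage u0_free (target_bag Rt).
have [R_core _] := stage_core s_stage v_owned; rewrite vR in R_core.
have l_gt0 : 0 < 2 * radius p + 6 by rewrite addnS.
have [blk [col blocks]] := R_core _ l_gt0.
have bound_R : radius p <= absorption_bound R p.
  by rewrite /absorption_bound Rp leq_addr.
have bound_R' := leq_trans bound_R (leq_addr (absorption_cost p) _).
have [s2 [s2_shaved s21 s2_near]] := colour_pass Rt Rp blocks false bound_R s1_shaved.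
have [s3 [s3_shaved s32 s3_near]] := colour_pass Rt Rp blocks true bound_R' s2_shaved.
exists s3; split; last 2 first.
- exact: subset_trans s21.
- apply/pred0P => w /=; apply/negP => /andP[w3 /fringeP[wC [k [y [kC yR wk ky]]]]].
  have w_colour : w \in fringe g H C (colour_class R col (col (anchor s y))).
    by apply/fringeP; split=> //; exists k, y; split=> //; rewrite inE yR eqxx.
  case: (col _) w_colour => w_colour;
    first by rewrite (disjointFr s3_near w3) in w_colour.
  by rewrite (disjointFr s2_near (subsetP s32 w w3)) in w_colour.
apply: shaved_leq s3_shaved => // X _; rewrite ltnS => /absorption_boundS->.
by rewrite mul2n -addnn addnA.
Qed.

Lemma shave_loop p : p <= 4 -> exists s', shaved (absorption_bound^~ p) p s' /\
  {in targets, forall R, depth B R < p -> [disjoint free s' & near R]}.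
Proof.
elim: p => [_|p IHp p4].
  exists s; split=> //; split; [exact: stage_owned s_stage | exact: extends_refl |].
  by move=> v v_free; rewrite v_free.
have [s1 [s1_shaved s1_near]] := IHp (ltnW p4).
have s1_shaved' := shaved_leq (fun R _ _ => leqnn _) (leqnSn p) s1_shaved.
have [/exists_inP[R Rt /eqP Rp]|no_target] :=
  boolP [exists R in targets, depth B R == p].
  have [s2 [s2_shaved s21 s2_near]] := shave_target Rt Rp s1_shaved'.
  exists s2; split=> // X Xt; rewrite ltnS leq_eqVlt => /orP[/eqP Xp|Xp].
    suff -> : X = R by [].
    apply: depth_inj (target_bag Xt) (target_bag Rt) _ _; last by rewrite Xp.
    exact: (bag_nested s_stage u0_free (target_bag Xt) (target_bag Rt)).
  exact: disjointWl s21 (s1_near X Xt Xp).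
exists s1; split.
  by apply: shaved_leq s1_shaved' => // R _ _; apply: absorption_bound_leqS.
move=> X Xt; rewrite ltnS leq_eqVlt => /orP[Xp|]; last exact: s1_near.
by case/negP: no_target; apply/exists_inP; exists X.
Qed.

Section ShavedStage.
Variable s' : assignment V.
Hypothesis s'_shaved : shaved (absorption_bound^~ 4) 4 s'.
Hypothesis s'_near : {in targets, forall R, [disjoint free s' & near R]}.

Definition shaved_bag v : {set {set V}} := if v \in C then abutting else b v.
Local Notation b' := shaved_bag.

Let ss' : extends s s'. Proof. exact: shaved_extends s'_shaved. Qed.
Let s'_free v : v \in free s' -> v \in free s. Proof. exact: (subsetP ss'.1). Qed.
Let s'_owned v : v \notin free s -> v \notin free s'.
Proof. exact: (extends_free ss'). Qed.

Let s'_region v : v \notin free s -> region s' v = region s v.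
Proof. by case/ss'.2. Qed.

Let s'_anchor v : v \notin free s -> anchor s' v = anchor s v.
Proof. by case/ss'.2. Qed.

Let new v : v \in free s -> v \notin free s' ->
  [/\ v \in C, region s' v \in targets, anchor s' v \notin free s &
      dist_le (linked (region s' v)) (radius (depth abutting (region s' v)))
        v (anchor s' v)].
Proof.
move=> v_free v_s'; have [[vC vt _] [va vd]] := shaved_new s'_shaved v_free v_s'.
by split=> //; apply: dist_le_leq vd; apply: absorption_bound_radius.
Qed.

Let far : free s :\: C \subset free s'.
Proof.
apply/subsetP => x /setDP[x_free xC]; apply: contraT => x_s'.
by have [] := new x_free x_s'; rewrite (negPf xC).
Qed.

Let region_old v : v \notin free s' ->
  exists2 w, w \notin free s & region s' v = region s w.
Proof.
move=> v_s'; have [v_free|v_owned] := boolP (v \in free s); last first.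
  by exists v; rewrite ?s'_region.
have [_ vt _ _] := new v_free v_s'.
by have [w w_owned <-] := bag_ownerP s_stage u0_free (target_bag vt); exists w.
Qed.

Let owner_sub R : owner s R \subset owner s' R.
Proof.
apply/subsetP => v /ownerP[v_owned <-]; apply/ownerP.
by rewrite s'_owned // s'_region.
Qed.

Let cores_eq R : cores s' R = cores s R.
Proof.
apply/setP => w; rewrite !inE.
have [w_free|w_owned] := boolP (w \in free s); last first.
  by rewrite (s'_owned w_owned) s'_region // s'_anchor.
apply/negP => /andP[/andP[w_s' _] /eqP wa]; have [_ _ + _] := new w_free w_s'.
by rewrite wa w_free.
Qed.

Let bag_sub u : u \in free s -> b' u \subset b u.
Proof.
move=> u_free; rewrite /b'; case: ifP => // uC.
rewrite (bag_component s_stage u0_free uC).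
exact: (abutting_bag s_stage u0_free).
Qed.

Lemma shaved_radius v : v \notin free s' ->
  dist_le (linked (region s' v)) (radius 0) v (anchor s' v).
Proof.
move=> v_s'; have [v_free|v_owned] := boolP (v \in free s).
  have [_ _ _ vd] := new v_free v_s'; apply: dist_le_leq vd; exact: radius_antitone.
by rewrite s'_region // s'_anchor //; apply: stage_radius s_stage _ v_owned.
Qed.

Lemma shaved_boundary u v : u \in free s' -> v \notin free s' -> g u v ->
  region s' v \in b' u /\
  dist_le (linked (region s' v)) (radius (depth (b' u) (region s' v))) v (anchor s' v).
Proof.
move=> /s'_free u_free v_s' uv; have [v_free|v_owned] := boolP (v \in free s).
  have [vC vt _ vd] := new v_free v_s'.
  by rewrite /b' (component_edge g_sym u0 u_free v_free uv) vC target_abutting.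
rewrite s'_region // s'_anchor //.
have vb := boundary_bag s_stage u_free v_owned uv.
have vd := boundary_radius s_stage u_free v_owned uv.
split; last by apply: dist_le_leq vd; apply/radius_antitone/depth_sub/bag_sub.
rewrite /b'; case: ifP => // uC; rewrite inE; apply/touchP; exists u, v.
by rewrite mem_owner.
Qed.

Let abutting_of_outside x R : x \in C -> may_own s' b' x R -> R \in abutting.
Proof.
move=> xC; rewrite /may_own /b' xC; case: ifP => // /negbT x_s' /eqP <-.
by have [_ /target_abutting] := new (component_free xC) x_s'.
Qed.

Let oldest_owner_before K R : oldest_owner s' b' K R -> oldest_owner s b K R.
Proof.
case=> KR K_region [x xK xR]; split=> //.
  move=> y yK y_owned; rewrite -s'_region //; apply: K_region => //; exact: s'_owned.
exists x => //; have [x_free|x_owned] := boolP (x \in free s); last first.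
  by move: xR; rewrite /may_own (negPf x_owned) (negPf (s'_owned x_owned)) s'_region.
rewrite /may_own x_free; have [xC|xC] := boolP (x \in C).
  rewrite (bag_component s_stage u0_free xC).
  exact: (subsetP (abutting_bag s_stage u0_free) _ (abutting_of_outside xC xR)).
have x_s' : x \in free s' by apply: (subsetP far); rewrite inE xC.
by move: xR; rewrite /may_own x_s' /b' (negPf xC).
Qed.

Lemma shaved_oldest u K R : u \in free s' -> connected_set g K -> in_member H K ->
  u \in K -> ~~ (K \subset component g (free s') u) ->
    oldest_owner s' b' K R -> R \in b' u.
Proof.
move=> u_s' K_conn K_member uK nK R_oldest; have u_free := s'_free u_s'.
have R_oldest' := oldest_owner_before R_oldest; have [KR K_region _] := R_oldest'.
rewrite /b'; case: ifP => uC; last first.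
  apply: (bag_oldest s_stage u_free K_conn K_member uK _ R_oldest').
  by rewrite -(component_far g_sym ss'.1 far) // inE uC.
have [KC|nKC] := boolP (K \subset C).
  by case: R_oldest => _ _ [x xK]; apply: abutting_of_outside; apply: subsetP xK.
have RB : R \in B.
  rewrite -(bag_component s_stage u0_free uC).
  by apply: (bag_oldest s_stage u_free K_conn K_member uK _ R_oldest');
    rewrite (component_eq g_sym uC).
apply: contraT => R_cut.
have [k [y [ku kC yK y_owned ky]]] := component_exit K_conn uK uC nKC.
have y_abut : region s y \in abutting.
  by rewrite inE; apply/touchP; exists k, y; rewrite mem_owner.
have yt : region s y \in targets.
  rewrite inE y_abut; apply/exists_inP; exists R; first by rewrite inE R_cut.
  by rewrite properEneq K_region // andbT; apply: contraNneq R_cut => <-.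
have u_near : u \in near (region s y).
  case/exists_inP: K_member => A AH KA; apply/fringeP; split=> //; exists k, y.
  split=> //; first exact: mem_owner.
  have uKC : u \in K :&: C by rewrite inE uK.
  have sub := component_sub g (K :&: C) u.
  apply: (linked_connected AH _ (subset_trans sub (subsetIr _ _))
    (mem_component g uKC)).
    exact: subset_trans sub (subset_trans (subsetIl _ _) KA).
  by apply: connect_component => //; move: ku; rewrite inE => /andP[].
by move: (disjointFr (s'_near yt) u_s'); rewrite u_near.
Qed.

Lemma shaved_region_edge v w : v \notin free s' -> w \notin free s' -> g v w ->
  nested (region s' v) (region s' w).
Proof.
have new_bag x : x \in free s -> x \notin free s' -> region s' x \in B.
  by move=> x_free /(new x_free)[_ /target_bag].
have nested_new x y : x \in free s -> x \notin free s' -> y \notin free s' -> g x y ->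
    nested (region s' x) (region s' y).
  move=> x_free x_s' y_s' xy; have [xC _ _ _] := new x_free x_s'.
  apply: (bag_nested s_stage u0_free (new_bag x x_free x_s')).
  have [y_free|y_owned] := boolP (y \in free s); first exact: new_bag.
  rewrite s'_region // -(bag_component s_stage u0_free xC).
  exact: (boundary_bag s_stage).
move=> v_s' w_s' vw.
have [v_free|v_owned] := boolP (v \in free s); first exact: nested_new.
have [w_free|w_owned] := boolP (w \in free s).
  by rewrite nestedC nested_new // g_sym.
by rewrite !s'_region //; apply: (region_edge s_stage).
Qed.

Lemma shaved_stage : stage g H s' b'.
Proof.
split.
- exact: shaved_owned s'_shaved.
- exact: shaved_radius.
- by move=> v /region_old[w w_owned ->]; rewrite cores_eq; apply: (stage_core s_stage).
- move=> u R /[dup] u_s' /s'_free u_free.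
  move=> /(subsetP (bag_sub u_free))/(bag_region s_stage u_free).
  by apply: subset_trans; apply: (component_mono g_sym ss'.1).
- move=> u R /s'_free u_free /(subsetP (bag_sub u_free))/(bag_owner s_stage u_free).
  by case/set0Pn => v vR; apply/set0Pn; exists v; apply: subsetP vR.
- move=> u /s'_free u_free.
  exact: leq_trans (subset_leq_card (bag_sub u_free)) (bag_card s_stage u_free).
- move=> u v /s'_free u_free /s'_free v_free uv.
  by rewrite /b' (component_edge g_sym u0 u_free v_free uv)
    (bag_edge s_stage u_free v_free uv).
- by move=> u v u_s' v_s' /(shaved_boundary u_s' v_s')[].
- by move=> u v u_s' v_s' /(shaved_boundary u_s' v_s')[].
- exact: shaved_oldest.
- move=> u R X /s'_free u_free.
  move=> /(subsetP (bag_sub u_free)) Rb /(subsetP (bag_sub u_free)) Xb RX.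
  have /touchP[x [y [xR yX xy]]] := bag_touch s_stage u_free Rb Xb RX.
  by apply/touchP; exists x, y; rewrite !(subsetP (owner_sub _)).
- move=> v w /region_old[v' v'_owned ->] /region_old[w' w'_owned ->].
  exact: (region_laminar s_stage).
- exact: shaved_region_edge.
- move=> v u /region_old[w w_owned ->] u_s'.
  move=> /(region_component s_stage w_owned (s'_free u_s')).
  by apply: subset_trans; apply: (component_mono g_sym ss'.1).
Qed.

Lemma shaved_step : step g H s b u0 B s' b'.
Proof.
split; [exact: shaved_stage | | exact: ss' | |].
- by split; [exact: subxx | exact: subsetUr | exact: (bag_card s_stage)].
- by move=> v v_free v_s'; have [vC /target_bag] := new v_free v_s'.
by move=> u _; rewrite /b'; case: ifP => // _; apply: (abutting_bag s_stage).
Qed.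

Lemma shaved_weight : ~~ (B \subset abutting) -> weight s' b' < weight s b.
Proof.
move=> cut; have := subset_leq_card ss'.1.
rewrite leq_eqVlt => /orP[/eqP e|]; last exact: weight_lt shaved_stage.
have free_eq : free s' = free s by apply/eqP; rewrite eqEcard ss'.1 e leqnn.
rewrite /weight free_eq ltn_add2l (bigD1 u0) //= [X in _ < X](bigD1 u0) //= -addSn.
apply: leq_add; last first.
  by apply: leq_sum => v /andP[v_free _]; apply/subset_leq_card/bag_sub.
rewrite /b' mem_component //; apply: proper_card.
by rewrite properE (abutting_bag s_stage u0_free) cut.
Qed.

End ShavedStage.

Lemma exists_shaved_step : ~~ (B \subset abutting) ->
  exists s' b', step g H s b u0 B s' b' /\ weight s' b' < weight s b.
Proof.
move=> cut; have [s' [s'_shaved s'_near]] := shave_loop (leqnn 4).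
have s'_near4 : {in targets, forall R, [disjoint free s' & near R]}.
  by move=> R Rt; apply: s'_near => //;
    apply: (bag_depth s_stage u0_free (target_bag Rt)).
exists s', shaved_bag; split; first exact: shaved_step.
exact: shaved_weight.
Qed.

End Shave.

Section Birth.
Variables (V : finType) (g : rel V) (H : {set {set V}}).
Hypothesis g_sym : symmetric g.
Hypothesis g_spans : spans g H.
Variables (s : assignment V) (b : V -> {set {set V}}) (u0 : V).
Hypothesis s_stage : stage g H s b.
Hypothesis u0_free : u0 \in free s.
Implicit Types (R T X K : {set V}) (u v w x y : V).
Local Notation linked := (linked g H).
Local Notation C := (component g (free s) u0).
Local Notation B := (b u0).
Local Notation abutting := (abutting g s u0).

Lemma bag_clique_minor : B \subset abutting -> clique_minor g #|B|.+1.
Proof.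
move=> /subsetP B_abut; exists (C :: [seq owner s R | R <- enum B]); split.
- by rewrite /= size_map -cardE.
- move=> A; rewrite inE => /orP[/eqP->|/mapP[R]]; first exact: component_connected.
  rewrite mem_enum => RB ->; apply: (owner_connected g_sym (stage_owned s_stage)).
  have [v v_owned <-] := bag_ownerP s_stage u0_free RB.
  by have [] := stage_core s_stage v_owned.
rewrite /= pairwise_map all_map; apply/andP; split.
  apply/allP => R; rewrite mem_enum => /B_abut; rewrite inE /= => ->; rewrite andbT.
  apply/pred0P => v /=; apply/negP => /andP[/component_free v_free].
  by rewrite inE v_free.
have := enum_uniq B; rewrite uniq_pairwise.
apply: (sub_in_pairwise (P := [in B])) => [R X RB XB RX|]; last first.
  by apply/allP => R; rewrite mem_enum.
rewrite /= (bag_touch s_stage u0_free RB XB RX) andbT.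
apply/pred0P => v /=; rewrite !inE.
apply/negP => /andP[/andP[_ /eqP vR] /andP[_ /eqP vX]].
by case/negP: RX; rewrite -vR -vX.
Qed.

Lemma bag_card_le3 : ~ clique_minor g 5 -> B \subset abutting -> #|B| <= 3.
Proof.
move=> no_minor B_abut; rewrite leqNgt; apply/negP => B_gt3; apply: no_minor.
suff -> : 5 = #|B|.+1 by apply: bag_clique_minor.
by apply/eqP; rewrite eqSS eqn_leq B_gt3 (bag_card s_stage).
Qed.

Lemma core_touching_bag : B \subset abutting -> #|B| <= 3 ->
  exists T, [/\ T \subset C, connected_set g T, core g H C T &
                {in B, forall R, touch g T (owner s R)}].
Proof.
move=> /subsetP B_abut B_le3; have C_conn := component_connected g_sym u0_free.
pose R i := nth set0 (enum B) i.
have terminal i :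
    exists2 t, t \in C & R i \in B -> exists2 y, y \in owner s (R i) & g t y.
  have [RB|] := boolP (R i \in B); last by exists u0; rewrite // mem_component.
  have := B_abut _ RB; rewrite inE => /touchP[t [y [tC yR ty]]].
  by exists t => // _; exists y.
have [t0 t0C h0] := terminal 0; have [t1 t1C h1] := terminal 1.
have [t2 t2C h2] := terminal 2.
have [T [[TC t0T t1T t2T] [T_conn T_core]]] :=
  core_exists g_sym g_spans C_conn t0C t1C t2C.
exists T; split=> // X XB.
have touch_R i t : t \in T -> (R i \in B -> exists2 y, y \in owner s (R i) & g t y) ->
    index X (enum B) = i -> touch g T (owner s X).
  move=> tT hi iX; have RX : R i = X by rewrite /R -iX nth_index // mem_enum.
  by case: hi; rewrite RX // => y yX ty; apply/touchP; exists t, y.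
have : index X (enum B) < 3.
  by apply: leq_trans B_le3; rewrite cardE index_mem mem_enum.
case iX: (index X (enum B)) => [|[|[|i]]] // _.
- exact: touch_R t0T h0 iX.
- exact: touch_R t1T h1 iX.
- exact: touch_R t2T h2 iX.
Qed.

Section NewOwner.
Variable T : {set V}.
Hypothesis T_sub : T \subset C.
Hypothesis T_connected : connected_set g T.
Hypothesis T_core : core g H C T.
Hypothesis T_touch : {in B, forall R, touch g T (owner s R)}.
Hypothesis B_card : #|B| <= 3.

Definition birth : assignment V :=
  Assignment (free s :\: T) (fun v => if v \in T then C else region s v)
    (fun v => if v \in T then v else anchor s v).
Local Notation s' := birth.

Definition birth_bag v : {set {set V}} := if v \in C then C |: b v else b v.
Local Notation b' := birth_bag.

Let TC v : v \in T -> v \in C. Proof. exact: (subsetP T_sub). Qed.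
Let T_free v : v \in T -> v \in free s. Proof. by move=> /TC/component_free. Qed.
Let owned_T v : v \notin free s -> v \notin T.
Proof. by apply: contra; apply: T_free. Qed.
Let s'_free v : v \in free s' -> v \in free s. Proof. by case/setDP. Qed.

Let s'_cases v : v \notin free s' -> v \in T \/ v \notin free s.
Proof. by rewrite in_setD negb_and negbK => /orP. Qed.

Let region_T v : v \in T -> region s' v = C. Proof. by rewrite /= => ->. Qed.
Let anchor_T v : v \in T -> anchor s' v = v. Proof. by rewrite /= => ->. Qed.

Let ss' : extends s s'.
Proof. by split=> [|v /owned_T/negPf vT]; [exact: subsetDl | rewrite /= vT]. Qed.

Let s'_owned v : v \notin free s -> v \notin free s'.
Proof. exact: (extends_free ss'). Qed.

Let T_owned v : v \in T -> v \notin free s'. Proof. by move=> vT; rewrite inE vT. Qed.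

Let s'_region v : v \notin free s -> region s' v = region s v.
Proof. by case/ss'.2. Qed.

Let s'_anchor v : v \notin free s -> anchor s' v = anchor s v.
Proof. by case/ss'.2. Qed.

Let region_neq v : v \notin free s -> region s v != C.
Proof.
move=> v_owned; apply/eqP => vC; have := mem_region (stage_owned s_stage) v_owned.
by rewrite vC => /component_free; apply/negP.
Qed.

Let owner_sub R : owner s R \subset owner s' R.
Proof.
apply/subsetP => v /ownerP[v_owned <-]; apply/ownerP.
by rewrite s'_owned // s'_region.
Qed.

Let T_owner : T \subset owner s' C.
Proof. by apply/subsetP => v vT; apply/ownerP; rewrite T_owned // region_T. Qed.

Let cores_C : cores s' C = T.
Proof.
apply/setP => w; apply/idP/idP => [|wT]; last first.
  by rewrite inE (subsetP T_owner) // anchor_T ?eqxx.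
rewrite inE => /andP[/ownerP[/s'_cases[//|w_owned]]].
by rewrite s'_region // => wC; case/eqP: (region_neq w_owned).
Qed.

Let cores_old R : R != C -> cores s' R = cores s R.
Proof.
move=> RC; apply/setP => w; rewrite !in_set; have [wT|wT] := boolP (w \in T).
  by rewrite (T_free wT) region_T // [C == R]eq_sym (negPf RC) andbF.
by rewrite /= (negPf wT).
Qed.

Let bag_birth u : u \in C -> b' u = C |: B.
Proof. by move=> uC; rewrite /b' uC (bag_component s_stage u0_free). Qed.

Let region_disjoint v : v \notin free s ->
  [disjoint C & region s v] || (C \subset region s v).
Proof.
move=> v_owned; have [//|/pred0Pn[x /andP[xC xv]]] := boolP [disjoint C & region s v].
have := region_component s_stage v_owned (component_free xC) xv.
by rewrite (component_eq g_sym xC).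
Qed.

Lemma birth_owned : owned g s'.
Proof.
have s_owned := stage_owned s_stage; split=> v /s'_cases[vT|v_owned].
- by rewrite region_T ?TC.
- by rewrite s'_region // (mem_region s_owned).
- by rewrite anchor_T ?T_owned.
- by rewrite s'_anchor // s'_owned // (anchor_not_free s_owned).
- by rewrite anchor_T.
- rewrite s'_anchor // !s'_region ?(region_anchor s_owned) //.
  exact: (anchor_not_free s_owned).
- by rewrite !anchor_T.
- by rewrite !s'_anchor ?(anchor_id s_owned) // (anchor_not_free s_owned).
- by rewrite anchor_T // connect0.
rewrite s'_anchor //; apply: connect_induced_sub (connect_anchor s_owned v_owned).
apply/subsetP => w; rewrite inE => /andP[w_owned /eqP wv].
by rewrite inE s'_owned // s'_anchor // wv eqxx.
Qed.

Lemma birth_core v : v \notin free s' ->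
  core g H (region s' v) (cores s' (region s' v)) /\
  connected_set g (cores s' (region s' v)).
Proof.
case/s'_cases=> [vT|v_owned]; first by rewrite region_T // cores_C.
by rewrite s'_region // cores_old ?region_neq //; apply: (stage_core s_stage).
Qed.

Lemma birth_bag_owner u R : u \in free s' -> R \in b' u ->
  component g (free s') u \subset R /\ owner s' R != set0.
Proof.
move=> u_s'; have u_free := s'_free u_s'.
have sub := component_mono g_sym ss'.1 u_s'.
have old : R \in b u -> component g (free s') u \subset R /\ owner s' R != set0.
  move=> Rb; split; first exact: subset_trans sub (bag_region s_stage u_free Rb).
  have [v vR] := set0Pn _ (bag_owner s_stage u_free Rb); apply/set0Pn; exists v.
  exact: subsetP vR.
rewrite /b'; case: ifP => uC; last exact: old.
case/setU1P=> [->|]; last exact: old.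
rewrite -{1}(component_eq g_sym uC) sub; split=> //.
have [/set0Pn[t tT] _] := T_connected; apply/set0Pn; exists t; exact: subsetP tT.
Qed.

Lemma birth_boundary u v : u \in free s' -> v \notin free s' -> g u v ->
  region s' v \in b' u /\
  dist_le (linked (region s' v)) (radius (depth (b' u) (region s' v))) v (anchor s' v).
Proof.
move=> /s'_free u_free /s'_cases[vT|v_owned] uv.
  have uC : u \in C by rewrite (component_edge g_sym u0 u_free (T_free vT) uv) TC.
  by rewrite region_T // anchor_T // /b' uC setU11; split=> //; apply: dist_le_refl.
have vb := boundary_bag s_stage u_free v_owned uv.
have vd := boundary_radius s_stage u_free v_owned uv.
rewrite s'_region // s'_anchor // /b'; case: ifP => // uC.
split; first by rewrite setU1r.
suff -> : depth (C |: b u) (region s v) = depth (b u) (region s v) by [].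
apply: eq_card => X; rewrite !inE; case: eqP => [->|//]; rewrite /=.
have Cv : C \subset region s v.
  apply: (component_bag s_stage u0_free).
  by rewrite -(bag_component s_stage u0_free uC).
by rewrite properE Cv andbF andbF.
Qed.

Let may_own_cases x R : x \in C -> may_own s' b' x R -> R = C \/ R \in B.
Proof.
move=> xC; rewrite /may_own; case: ifP => [_|/negbT/s'_cases[xT|]].
- by rewrite bag_birth // => /setU1P.
- by rewrite region_T // => /eqP; left.
- by rewrite (component_free xC).
Qed.

Let oldest_owner_before K R : R != C -> oldest_owner s' b' K R -> oldest_owner s b K R.
Proof.
move=> RC [KR K_region [x xK xR]]; split=> //.
  by move=> y yK y_owned; rewrite -s'_region //; apply: K_region; rewrite ?s'_owned.
exists x => //; have [x_free|x_owned] := boolP (x \in free s); last first.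
  by move: xR; rewrite /may_own (negPf x_owned) (negPf (s'_owned x_owned)) s'_region.
rewrite /may_own x_free; have [xC|xC] := boolP (x \in C).
  have [RC'|] := may_own_cases xC xR; first by rewrite RC' eqxx in RC.
  by rewrite (bag_component s_stage u0_free xC).
have x_s' : x \in free s' by rewrite inE x_free andbT; apply: contra xC; apply: TC.
by move: xR; rewrite /may_own x_s' /b' (negPf xC).
Qed.

Lemma birth_oldest u K R : u \in free s' -> connected_set g K -> in_member H K ->
  u \in K -> ~~ (K \subset component g (free s') u) ->
    oldest_owner s' b' K R -> R \in b' u.
Proof.
move=> /s'_free u_free K_conn K_member uK nK R_oldest.
have [KR _ [x xK xR]] := R_oldest.
have far : free s :\: C \subset free s' by apply: setDS.
rewrite /b'; case: ifP => uC; last first.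
  have RC : R != C by apply: contraFneq uC => <-; apply: (subsetP KR).
  apply: (bag_oldest s_stage u_free K_conn K_member uK _
    (oldest_owner_before RC R_oldest)).
  by rewrite -(component_far g_sym ss'.1 far) // inE uC.
have [->|RC] := eqVneq R C; first exact: setU11.
apply: setU1r; have [KC|nKC] := boolP (K \subset C).
  rewrite (bag_component s_stage u0_free uC).
  by case: (may_own_cases (subsetP KC x xK) xR) => // RC'; rewrite RC' eqxx in RC.
apply: (bag_oldest s_stage u_free K_conn K_member uK _
  (oldest_owner_before RC R_oldest)).
by rewrite (component_eq g_sym uC).
Qed.

Lemma birth_touch u R X : u \in free s' -> R \in b' u -> X \in b' u -> R != X ->
  touch g (owner s' R) (owner s' X).
Proof.
move=> /s'_free u_free.
have old Y Z : Y \in b u -> Z \in b u -> Y != Z -> touch g (owner s' Y) (owner s' Z).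
  move=> Yb Zb YZ; have /touchP[x [y [xY yZ xy]]] := bag_touch s_stage u_free Yb Zb YZ.
  by apply/touchP; exists x, y; rewrite !(subsetP (owner_sub _)).
have new Y : Y \in B -> touch g (owner s' C) (owner s' Y).
  case/T_touch/touchP=> x [y [xT yY xy]]; apply/touchP; exists x, y.
  by rewrite (subsetP T_owner) ?(subsetP (owner_sub _)).
rewrite /b'; case: ifP => uC; last exact: old.
have bB := bag_component s_stage u0_free uC.
move=> /setU1P[->|Rb] /setU1P[->|Xb]; rewrite ?eqxx //.
- by rewrite bB in Xb; rewrite new.
- by rewrite bB in Rb; rewrite touch_sym // new.
- exact: old.
Qed.

Lemma birth_region_laminar v w : v \notin free s' -> w \notin free s' ->
  [disjoint region s' v & region s' w] || nested (region s' v) (region s' w).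
Proof.
move=> /s'_cases[vT|v_owned] /s'_cases[wT|w_owned].
- by rewrite (region_T vT) (region_T wT) /nested subxx !orbT.
- rewrite (region_T vT) (s'_region w_owned) /nested.
  by case/orP: (region_disjoint w_owned) => ->; rewrite ?orbT.
- rewrite (s'_region v_owned) (region_T wT) disjoint_sym /nested.
  by case/orP: (region_disjoint v_owned) => ->; rewrite ?orbT.
- by rewrite !s'_region //; apply: (region_laminar s_stage).
Qed.

Lemma birth_region_edge v w : v \notin free s' -> w \notin free s' -> g v w ->
  nested (region s' v) (region s' w).
Proof.
have nested_new x y : x \in T -> y \notin free s -> g x y -> C \subset region s y.
  move=> xT y_owned xy; apply: (component_bag s_stage u0_free).
  rewrite -(bag_component s_stage u0_free (TC xT)).
  exact: (boundary_bag s_stage (T_free xT)).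
move=> /s'_cases[vT|v_owned] /s'_cases[wT|w_owned] vw.
- by rewrite (region_T vT) (region_T wT) /nested subxx.
- by rewrite (region_T vT) (s'_region w_owned) /nested (nested_new v w).
- by rewrite (s'_region v_owned) (region_T wT) /nested (nested_new w v) ?orbT // g_sym.
- by rewrite !s'_region //; apply: (region_edge s_stage).
Qed.

Lemma birth_stage : stage g H s' b'.
Proof.
split.
- exact: birth_owned.
- move=> v /s'_cases[vT|v_owned]; first by rewrite anchor_T //; apply: dist_le_refl.
  by rewrite s'_region // s'_anchor //; apply: (stage_radius s_stage).
- exact: birth_core.
- by move=> u R u_s' Rb; have [] := birth_bag_owner u_s' Rb.
- by move=> u R u_s' Rb; have [] := birth_bag_owner u_s' Rb.
- move=> u /s'_free u_free; rewrite /b'.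
  case: ifP => uC; last exact: (bag_card s_stage).
  rewrite (bag_component s_stage u0_free uC) cardsU1.
  exact: leq_add (leq_b1 _) B_card.
- move=> u v /s'_free u_free /s'_free v_free uv.
  by rewrite /b' (component_edge g_sym u0 u_free v_free uv)
    (bag_edge s_stage u_free v_free uv).
- by move=> u v u_s' v_s' /(birth_boundary u_s' v_s')[].
- by move=> u v u_s' v_s' /(birth_boundary u_s' v_s')[].
- exact: birth_oldest.
- exact: birth_touch.
- exact: birth_region_laminar.
- exact: birth_region_edge.
- move=> v u v_s' u_s'; have sub := component_mono g_sym ss'.1 u_s'.
  have u_free := s'_free u_s'; case/s'_cases: v_s' => [vT|v_owned].
    by rewrite region_T // => /(component_eq g_sym) <-.
  rewrite s'_region // => /(region_component s_stage v_owned u_free).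
  exact: subset_trans.
Qed.

Lemma birth_step : step g H s b u0 (C |: B) s' b'.
Proof.
split; [exact: birth_stage | | exact: ss' | |].
- split; [exact: subsetUr | exact: subxx |].
  by rewrite cardsU1; apply: leq_add (leq_b1 _) B_card.
- move=> v v_free /s'_cases[vT|]; last by rewrite v_free.
  by rewrite region_T // setU11 TC.
- by move=> u _; rewrite /b'; case: ifP => // uC;
    rewrite (bag_component s_stage u0_free uC).
Qed.

Lemma birth_weight : weight s' b' < weight s b.
Proof.
apply: (weight_lt _ birth_stage); apply: proper_card; apply/properP.
split; first exact: subsetDl.
have [/set0Pn[t tT] _] := T_connected; exists t; [exact: T_free | exact: T_owned].
Qed.

End NewOwner.

Lemma exists_birth_step : ~ clique_minor g 5 -> B \subset abutting ->
  exists s' b', step g H s b u0 (C |: B) s' b' /\ weight s' b' < weight s b.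
Proof.
move=> no_minor B_abut; have B_card := bag_card_le3 no_minor B_abut.
have [T [TC T_conn T_core T_touch]] := core_touching_bag B_abut B_card.
exists (birth T), birth_bag; split; first exact: birth_step.
exact: birth_weight.
Qed.

End Birth.

Section Completion.
Variables (V : finType) (g : rel V) (H : {set {set V}}).
Hypothesis g_sym : symmetric g.
Hypothesis g_spans : spans g H.
Implicit Types (K R X : {set V}) (a u v w x y : V) (s : assignment V).
Implicit Types (b beta : V -> {set {set V}}).
Local Notation stage := (stage g H).
Local Notation component := (component g).

Definition lists_oldest_owners s b a (S : {set {set V}}) : Prop := #|S| <= 4 /\
  forall K R, connected_set g K -> in_member H K -> a \in K ->
    oldest_owner s b K R -> R \in S.

Record completion s b s' b' beta : Prop := Completion {
  completion_stage : stage s' b';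
  completion_free : free s' = set0;
  completion_region : forall v, v \notin free s -> region s' v = region s v;
  completion_new : forall x, x \in free s ->
    region s' x \in b x \/ region s' x \subset component (free s) x;
  completion_oldest : forall a, a \in free s -> lists_oldest_owners s' b' a (beta a)
}.

Section StepCompletion.
Variables (s s1 s' : assignment V) (b b1 b' beta : V -> {set {set V}}).
Variables (u0 : V) (P : {set {set V}}).
Hypothesis s_stage : stage s b.
Hypothesis u0_free : u0 \in free s.
Hypothesis s_step : step g H s b u0 P s1 b1.
Hypothesis s1_completion : completion s1 b1 s' b' beta.
Local Notation C := (component (free s) u0).
Local Notation B := (b u0).

Let B_palette : B \subset P. Proof. by have [] := step_palette s_step. Qed.

Let palette_cases X : X \in P -> X = C \/ X \in B.
Proof. by have [_ /subsetP PC _] := step_palette s_step => /PC/setU1P. Qed.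

Let s'_free v : v \notin free s'.
Proof. by rewrite (completion_free s1_completion) inE. Qed.

Let step_region v : v \notin free s -> region s' v = region s v.
Proof.
move=> v_owned; have ss1 := step_extends s_step.
rewrite (completion_region s1_completion) ?(extends_free ss1) //.
by have [] := ss1.2 v v_owned.
Qed.

Lemma step_completion_new x : x \in free s ->
  region s' x \in b x \/ region s' x \subset component (free s) x.
Proof.
move=> x_free.
have in_P X : x \in C -> X \in P -> X \in b x \/ X \subset component (free s) x.
  move=> xC /palette_cases[->|XB]; first by right; rewrite (component_eq g_sym xC).
  by left; rewrite (bag_component s_stage u0_free xC).
have [x_s1|x_s1] := boolP (x \in free s1); last first.
  have [xC xP] := step_new s_step x_free x_s1.
  by apply: in_P; rewrite // (completion_region s1_completion).
have [xb|x_sub] := completion_new s1_completion x_s1; last first.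
  right; apply: (subset_trans x_sub).
  exact: (component_mono g_sym (step_extends s_step).1 x_s1).
have := subsetP (step_bag s_step x_s1) _ xb.
by case: ifP => xC; [apply: in_P | left].
Qed.

Lemma step_lists_oldest_owners a : a \in free s -> a \notin free s1 ->
  lists_oldest_owners s' b' a P.
Proof.
move=> a_free a_s1; have [aC aP] := step_new s_step a_free a_s1.
rewrite -(completion_region s1_completion a_s1) in aP.
split=> [|K R K_conn K_member aK [KR K_region [x xK]]].
  by have [] := step_palette s_step.
rewrite /may_own (negPf (s'_free x)) => /eqP xR.
have [KC|nKC] := boolP (K \subset C); last first.
  apply: (subsetP B_palette); rewrite -(bag_component s_stage u0_free aC).
  apply: (bag_oldest s_stage a_free K_conn K_member aK).
    by rewrite (component_eq g_sym aC).
  split=> // [y yK y_owned|]; first by rewrite -step_region // K_region ?s'_free.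
  exists x => //; rewrite /may_own; case: ifPn => x_free;
    last by rewrite -step_region // xR.
  have := step_completion_new x_free; rewrite xR => -[//|Rx]; case/negP: nKC.
  have ax : a \in component (free s) x by apply: (subsetP Rx); apply: (subsetP KR).
  by apply: subset_trans KR _; rewrite -(component_eq g_sym aC) (component_eq g_sym ax).
have xC := subsetP KC x xK; have := step_completion_new (component_free xC).
rewrite xR (bag_component s_stage u0_free xC) (component_eq g_sym xC).
case=> [/(subsetP B_palette)//|RC]; suff <- : region s' a = R by [].
apply/eqP; rewrite eqEsubset K_region ?s'_free //=; apply: subset_trans RC _.
by case: (palette_cases aP) => [->//|]; apply: (component_bag s_stage u0_free).
Qed.

Lemma step_completion : exists beta', completion s b s' b' beta'.
Proof.
exists (fun a => if a \in free s1 then beta a else P); split.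
- exact: completion_stage s1_completion.
- exact: completion_free s1_completion.
- exact: step_region.
- exact: step_completion_new.
- move=> a a_free; case: ifPn => a_s1; first exact: (completion_oldest s1_completion).
  exact: step_lists_oldest_owners.
Qed.

End StepCompletion.

Lemma completion_exists s b : ~ clique_minor g 5 -> stage s b ->
  exists s' b' beta, completion s b s' b' beta.
Proof.
move=> no_minor; have [n] := ubnP (weight s b).
elim: n s b => // n IHn s b lt_n s_stage.
have [free0|/set0Pn[u0 u0_free]] := eqVneq (free s) set0.
  by exists s, b, b; split=> // x; rewrite free0 inE.
have [P [s1 [b1 [s_step lt_w]]]] : exists P s1 b1,
    step g H s b u0 P s1 b1 /\ weight s1 b1 < weight s b.
  have [abut|cut] := boolP (b u0 \subset abutting g s u0).
    by exists (component (free s) u0 |: b u0); apply: exists_birth_step.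
  by exists (b u0); apply: exists_shaved_step.
have [s' [b' [beta s1_completion]]] :=
  IHn s1 b1 (leq_trans lt_w lt_n) (step_stage s_step).
exists s', b'; exact: step_completion s_step s1_completion.
Qed.

Lemma initial_stage : stage (Assignment setT (fun=> set0) id) (fun=> set0).
Proof.
split=> /= [|v|v|u R _|u R _|u _|u v _|u v _|u v _|u K R _ _ _ uK _ [_ _ [x _]]
           |u R X _|v w|v w|v u];
  rewrite ?inE ?cards0 //.
- by split=> v; rewrite inE.
- by rewrite /may_own /= !inE.
Qed.

Lemma final_stage_exists : ~ clique_minor g 5 -> exists s b beta,
  [/\ stage s b, free s = set0 & forall a, lists_oldest_owners s b a (beta a)].
Proof.
move=> no_minor; have [s [b [beta [s_stage s_free _ _ oldest]]]] :=
  completion_exists no_minor initial_stage.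
by exists s, b, beta; split=> // a; apply: oldest; rewrite inE.
Qed.

End Completion.

(** * From owners to an impression *)

Lemma impression_leq (T : finType) (e : rel T) (C M : {set {set T}}) x y x' y' :
  x <= x' -> y <= y' -> impression e C M x y -> impression e C M x' y'.
Proof.
move=> xx' yy' [M_conn M_triv M_cover M_diam C_diam]; split=> // [A AM|A AC] X Y XA YA.
  exact: dist_le_leq xx' (M_diam A AM X Y XA YA).
exact: dist_le_leq yy' (C_diam A AC X Y XA YA).
Qed.

Lemma dist_le_RIG (V : finType) (g : rel V) (H : {set {set V}}) n x y A B :
  dist_le (linked g H setT) n x y -> A \in H -> x \in A -> B \in H -> y \in B ->
  dist_le (RIG H) n.+1 A B.
Proof.
have RIG1 X Y z : X \in H -> Y \in H -> z \in X -> z \in Y -> dist_le (RIG H) 1 X Y.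
  move=> XH YH zX zY; have [->|XY] := eqVneq X Y; first exact: dist_le_refl.
  apply: dist_le1; rewrite /RIG /= XH YH XY /=.
  by apply/pred0Pn; exists z; rewrite /= zX.
case=> p [pp <- pn] AH xA BH yB; apply: (@dist_le_leq _ _ (size p).+1) => //.
elim: p x A AH xA pp yB {pn} => [|z p IHp] x A AH xA /=.
  by move=> _; apply: RIG1 xA.
case/andP=> xz pz yB.
case/orP: xz => [/eqP xz|/exists_inP[X XH /and3P[/setIP[xX _] /setIP[zX _] _]]].
  by rewrite -xz in pz yB; apply: (dist_le_leq (leqnSn _) (IHp x A AH xA pz yB)).
exact: (dist_le_trans (RIG1 _ _ _ AH XH xA xX) (IHp z X XH zX pz yB)).
Qed.

Section IntersectionMinor.
Variables (V : finType) (g : rel V) (M : {set {set V}}).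
Hypothesis g_sym : symmetric g.

Lemma IM_sym : symmetric (IM g M).
Proof.
move=> X Y; rewrite /IM /= eq_sym touch_sym //.
by case: (X \in M); case: (Y \in M); rewrite /= ?andbF.
Qed.

Lemma dist_le_IM1 X Y x y : X \in M -> Y \in M -> x \in X -> y \in Y -> g x y ->
  dist_le (IM g M) 1 X Y.
Proof.
move=> XM YM xX yY xy; have [->|XY] := eqVneq X Y; first exact: dist_le_refl.
by apply: dist_le1; rewrite /IM /= XM YM XY /=; apply/touchP; exists x, y.
Qed.

End IntersectionMinor.

Section Cells.
Variables (V : finType) (g : rel V) (H : {set {set V}}).
Hypothesis g_sym : symmetric g.
Implicit Types (A K R X Y : {set V}) (u v w x y : V).
Local Notation linked := (linked g H).

Variables (s : assignment V) (b beta : V -> {set {set V}}).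
Hypothesis s_stage : stage g H s b.
Hypothesis s_free : free s = set0.
Hypothesis beta_oldest : forall a, lists_oldest_owners g H s b a (beta a).

(* Adjacent vertices of one owner have anchors at distance less than [block_scale]. *)
Definition block_scale : nat := 2 * radius 0 + 2.

Variables (blk : {set V} -> V -> nat * nat) (col : {set V} -> V -> bool).
Hypothesis blocks : forall v, block_system g H (region s v) (cores s (region s v))
  block_scale (blk (region s v)) (col (region s v)).

Let s_owned : owned g s. Proof. exact: stage_owned s_stage. Qed.
Let not_free v : v \notin free s. Proof. by rewrite s_free inE. Qed.
Let mem_core v : anchor s v \in cores s (region s v).
Proof. exact: (anchor_core s_owned). Qed.

Let mem_core_eq v w : region s w = region s v -> anchor s w \in cores s (region s v).
Proof. by move=> <-. Qed.

Let dist_anchor v : dist_le (linked (region s v)) (radius 0) v (anchor s v).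
Proof. exact: (stage_radius s_stage). Qed.

Definition cell v : {set V} := [set u | (region s u == region s v) &&
  (blk (region s v) (anchor s u) == blk (region s v) (anchor s v))].

Definition cells : {set {set V}} := [set cell v | v : V].

Lemma cellP u v : reflect (region s u = region s v /\
  blk (region s v) (anchor s u) = blk (region s v) (anchor s v)) (u \in cell v).
Proof. by rewrite inE; apply: (iffP andP) => -[/eqP ? /eqP]. Qed.

Lemma mem_cell v : v \in cell v. Proof. exact/cellP. Qed.

Lemma cell_in_cells v : cell v \in cells. Proof. exact: imset_f. Qed.

Lemma cell_eq u v : u \in cell v -> cell u = cell v.
Proof.
case/cellP=> uv_region uv_blk; apply/setP => w.
by rewrite !inE uv_region uv_blk.
Qed.

Lemma core_cell v w : w \in cores s (region s v) ->
  blk (region s v) w = blk (region s v) (anchor s v) -> w \in cell v.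
Proof.
rewrite inE => /andP[/ownerP[_ w_region] /eqP w_anchor] w_blk.
by apply/cellP; rewrite w_region w_anchor.
Qed.

Lemma cell_connected v : connected_set g (cell v).
Proof.
split=> [|u w uv wv]; first by apply/set0Pn; exists v; apply: mem_cell.
have to_anchor x : x \in cell v -> connect (induced g (cell v)) x (anchor s x).
  move=> /cellP[x_region x_blk].
  apply: connect_induced_sub (connect_anchor s_owned (not_free x)).
  apply/subsetP => z; rewrite inE not_free => /eqP zx; apply/cellP.
  by rewrite zx -(region_anchor s_owned (not_free z)) zx (region_anchor s_owned).
apply: connect_trans (to_anchor u uv) _; rewrite connect_induced_sym //.
apply: connect_trans (to_anchor w wv) _; rewrite connect_induced_sym //.
have [[u_region u_blk] [w_region w_blk]] := (cellP _ _ uv, cellP _ _ wv).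
apply: connect_induced_sub (block_connect (blocks v) (mem_core_eq u_region)
  (mem_core_eq w_region) (etrans u_blk (esym w_blk))).
apply/subsetP => z; rewrite inE => /andP[z_core /eqP z_blk].
by apply: core_cell; rewrite // z_blk.
Qed.

Lemma cells_trivIset : trivIset cells.
Proof.
apply/trivIsetP => X Y /imsetP[u _ ->] /imsetP[v _ ->]; apply: contraNT.
by case/pred0Pn => w /andP[/cell_eq <- /cell_eq <-].
Qed.

Lemma cover_cells : cover cells = [set: V].
Proof.
apply/setP => v; rewrite inE; apply/bigcupP; exists (cell v); last exact: mem_cell.
exact: cell_in_cells.
Qed.

Lemma cell_diam v : weak_diam_le (RIG H) (meeting H (cell v))
  (radius 0 + 2 * block_scale + radius 0).+1.
Proof.
move=> A A'; rewrite !inE => /andP[AH /pred0Pn[x /andP[/= xA xv]]].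
case/andP=> A'H /pred0Pn[y /andP[/= yA' yv]].
have [[x_region x_blk] [y_region y_blk]] := (cellP _ _ xv, cellP _ _ yv).
have d := block_diam (blocks v) (mem_core_eq x_region) (mem_core_eq y_region)
  (etrans x_blk (esym y_blk)).
have [dx dy] := (dist_anchor x, dist_anchor y).
rewrite x_region in dx; rewrite y_region in dy.
have dxy := dist_le_trans (dist_le_trans dx d) (dist_le_sym (linked_sym H g_sym _) dy).
exact: dist_le_RIG (dist_le_sub (linked_sub (subsetT _)) dxy) AH xA A'H yA'.
Qed.

Lemma youngest_region_top K : connected_set g K ->
  exists2 x, x \in K & {in K, forall y, region s y \subset region s x}.
Proof.
move=> [/set0Pn[u uK] K_conn].
have [x xK x_max] := arg_maxnP (fun x => #|region s x|) uK.
exists x => // y yK; apply: contraT => nyx.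
have [||p [q [[pK qK px qx] [pq _]]]] := @connect_induced_exit _ g _
  (fun z => region s z \subset region s x) _ _ (K_conn x y xK yK) => //.
have qp : region s p \subset region s q.
  case/orP: (region_edge s_stage (not_free p) (not_free q) pq) => // qp.
  by case/negP: qx; apply: subset_trans px.
have p_region := mem_region s_owned (not_free p).
case/orP: (region_laminar s_stage (not_free x) (not_free q)) => [xq|/orP[xq|xq]].
- by move: (disjointFr xq (subsetP px _ p_region)); rewrite (subsetP qp).
- case/negP: qx; suff -> : region s x = region s q by [].
  by apply/eqP; rewrite eqEcard xq; apply: x_max.
- by case/negP: qx.
Qed.

Lemma same_owner_cells_close K x y : connected_set g K -> in_member H K ->
  K \subset region s x -> x \in K -> y \in K -> region s y = region s x ->
  dist_le (IM g cells) 1 (cell x) (cell y).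
Proof.
move=> [_ K_conn] /exists_inP[A AH KA] Kx xK yK yx.
have xy := linked_connected AH KA Kx xK (K_conn x y xK yK).
have [dx dy] := (dist_anchor x, dist_anchor y); rewrite yx in dy.
have d := dist_le_trans
  (dist_le_trans (dist_le_sym (linked_sym H g_sym _) dx) (dist_le1 xy)) dy.
have scale : radius 0 + 1 + radius 0 < block_scale.
  by rewrite /block_scale mul2n -addnn addn1 addn2 addSn.
have [blk_xy|] := block_touch (blocks x) (mem_core x) (mem_core_eq yx) d scale.
  suff -> : cell x = cell y by apply: dist_le_refl.
  by apply/esym/cell_eq/cellP; rewrite yx blk_xy.
case=> x' [y' [x'R y'R x'_blk y'_blk x'y']].
apply: dist_le_IM1 (cell_in_cells x) (cell_in_cells y) _ _ x'y'; first exact: core_cell.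
by apply: core_cell; rewrite yx.
Qed.

(* The bound on the distance of the cells of a connected part of a member of [H]
   in terms of the number [k] of owners that may still be its oldest owner. *)
Fixpoint hops (k : nat) : nat := if k is k'.+1 then 2 * hops k' + 3 else 0.

Lemma region_top_beta K x : connected_set g K -> in_member H K -> x \in K ->
  {in K, forall y, region s y \subset region s x} ->
  K \subset region s x /\ {in K, forall y, region s x \in beta y}.
Proof.
move=> K_conn K_member xK x_top.
have Kx : K \subset region s x.
  by apply/subsetP => y yK; apply/(subsetP (x_top y yK))/(mem_region s_owned).
split=> // y yK; apply: ((beta_oldest y).2 K _ K_conn K_member yK).
split=> // [z zK _|]; first exact: x_top.
by exists x; rewrite // /may_own (negPf (not_free x)).
Qed.

Lemma cells_diam k K (S : {set {set V}}) :
  connected_set g K -> in_member H K -> #|S| + k = 4 ->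
  {in K, forall v, S \subset beta v /\ region s v \notin S} ->
  {in K &, forall u v, dist_le (IM g cells) (hops k) (cell u) (cell v)}.
Proof.
elim: k K S => [|k IHk] K S K_conn K_member S_card S_beta u v uK vK;
  have [x xK x_top] := youngest_region_top K_conn;
  have [Kx x_beta] := region_top_beta K_conn K_member xK x_top.
  have [S_x x_S] := S_beta x xK; case/negP: x_S; suff -> : S = beta x by apply: x_beta.
  by apply/eqP; rewrite eqEcard S_x -(addn0 #|S|) S_card (beta_oldest x).1.
have to_x w : w \in K -> exists y, [/\ y \in K, region s y = region s x &
    dist_le (IM g cells) (hops k).+1 (cell w) (cell y)].
  move=> wK; have [wx|wx] := eqVneq (region s w) (region s x).
    by exists w; split=> //; apply: dist_le_refl.
  pose K' := component g [set y in K | region s y != region s x] w.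
  have wK' : w \in K' by apply: mem_component; rewrite inE wK.
  have K'_sub y : y \in K' -> y \in K /\ region s y != region s x.
    by move/(subsetP (component_sub _ _ _)); rewrite inE => /andP.
  have [||p [q [[pK qK pK' qK'] [pq _]]]] := @connect_induced_exit _ g _
      (fun y => y \in K') _ _ (K_conn.2 w x wK xK) => //.
    by apply/negP => /K'_sub[_ /eqP].
  have qx : region s q = region s x.
    apply/eqP; apply: contraNT qK' => qx; apply: (component_closed pK' _ pq).
    by rewrite inE qK.
  exists q; split=> //; rewrite -addn1.
  apply: dist_le_trans
    (dist_le_IM1 (cell_in_cells p) (cell_in_cells q) (mem_cell p) (mem_cell q) pq).
  apply: (IHk K' (region s x |: S)) => //.
  - by apply: component_connected; rewrite // inE wK.
  - case/exists_inP: K_member => A AH KA; apply/exists_inP; exists A => //.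
    by apply/subsetP => y /K'_sub[yK _]; apply: (subsetP KA).
  - by have [_ x_S] := S_beta x xK; rewrite cardsU1 x_S /= add1n addSnnS.
  - move=> y /K'_sub[yK yx]; have [S_y y_S] := S_beta y yK.
    by rewrite subUset sub1set x_beta // S_y in_setU1 negb_or yx.
have [[y [yK yx uy]] [z [zK zx vz]]] := (to_x u uK, to_x v vK).
have yz : dist_le (IM g cells) 1 (cell y) (cell z).
  by apply: same_owner_cells_close K_conn K_member _ yK zK _; rewrite ?yx.
have := dist_le_trans (dist_le_trans uy yz) (dist_le_sym (IM_sym cells g_sym) vz).
by apply: dist_le_leq; rewrite /= addn1 mul2n -addnn addn3 addSn addnS.
Qed.

Lemma cells_impression : (forall A, A \in H -> connected_set g A) ->
  impression g H cells (radius 0 + 2 * block_scale + radius 0).+1 (hops 4).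
Proof.
move=> H_conn; split.
- by move=> X /imsetP[v _ ->]; apply: cell_connected.
- exact: cells_trivIset.
- exact: cover_cells.
- by move=> X /imsetP[v _ ->]; apply: cell_diam.
move=> A AH X Y.
rewrite !inE => /andP[/imsetP[v _ ->] /pred0Pn[x /andP[/cell_eq <- xA]]].
case/andP=> /imsetP[w _ ->] /pred0Pn[y /andP[/cell_eq <- yA]].
apply: (cells_diam (S := set0) (H_conn A AH)) => //.
- by apply/exists_inP; exists A.
- by rewrite cards0.
- by move=> z _; rewrite sub0set inE.
Qed.

End Cells.

Theorem clique_minor_free_impression (V : finType) (g : rel V) (H : {set {set V}}) :
  symmetric g -> spans g H -> (forall A, A \in H -> connected_set g A) ->
  ~ clique_minor g 5 -> exists M, impression g H M 50405 45.
Proof.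
move=> g_sym g_spans H_conn no_minor.
have [s [b [beta [s_stage s_free beta_oldest]]]] :=
  final_stage_exists g_sym g_spans no_minor.
have block_system_exists R : exists F : (V -> nat * nat) * (V -> bool),
    [exists v, region s v == R] -> block_system g H R (cores s R) block_scale F.1 F.2.
  have [/existsP[v /eqP <-]|_] := boolP [exists v, region s v == R].
    have v_owned : v \notin free s by rewrite s_free inE.
    have [v_core _] := stage_core s_stage v_owned.
    by have [//|blk [col blocks]] := v_core block_scale; exists (blk, col).
  by exists (fun=> (0, 0), fun=> false).
have [F blocks] := fin_all_exists block_system_exists.
exists (cells s (fun R => (F R).1)).
apply: (impression_leq _ _ (cells_impression g_sym s_stage s_free beta_oldest
  (col := fun R => (F R).2) _ H_conn)) => //.
by move=> v; apply: blocks; apply/existsP; exists v.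
Qed.

(** * Parity of crossings of lattice paths *)

Section Crossings.
Variable T : eqType.
Implicit Types (e : rel T) (P Q : T -> T -> bool) (F : T -> bool) (x : T) (p : seq T).

Fixpoint crossings P x p : bool :=
  if p is y :: p' then P x y (+) crossings P y p' else false.

Lemma crossings_addb P Q x p :
  crossings (fun y z => P y z (+) Q y z) x p = crossings P x p (+) crossings Q x p.
Proof. by elim: p x => [|y p IHp] x //=; rewrite IHp addbACA. Qed.

Lemma crossings_telescope F x p :
  crossings (fun y z => F y (+) F z) x p = F x (+) F (last x p).
Proof.
by elim: p x => [|y p IHp] x /=; [rewrite addbb | rewrite IHp addbA addbK].
Qed.

Lemma eq_in_crossings e P Q x p : path e x p ->
  {in x :: p &, forall y z, e y z -> P y z = Q y z} ->
    crossings P x p = crossings Q x p.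
Proof.
elim: p x => [|y p IHp] x //= /andP[xy pp] PQ.
rewrite PQ ?inE ?eqxx ?orbT // IHp // => z z' zp z'p.
by apply: PQ; rewrite inE (zp, z'p) orbT.
Qed.

End Crossings.

Section Lattice.
Local Open Scope ring_scope.
Local Notation pt := (int * int)%type.
Implicit Types (a k s t x y z : pt) (p q : seq pt) (S : pt -> Prop).

Definition grid_adj : rel pt := [rel s t | `|s.1 - t.1| + `|s.2 - t.2| == 1].

Lemma grid_adj_sym : symmetric grid_adj.
Proof. by move=> s t; rewrite /grid_adj /= (distrC s.1) (distrC s.2). Qed.

Lemma grid_adjP s t : grid_adj s t ->
  [\/ s = (t.1, t.2 + 1), t = (s.1, s.2 + 1), s = (t.1 + 1, t.2) | t = (s.1 + 1, s.2)].
Proof.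
case: s t => [s1 s2] [t1 t2]; rewrite /grid_adj /= => st.
have : [|| (s1 == t1) && (s2 == t2 + 1), (t1 == s1) && (t2 == s2 + 1),
           (s1 == t1 + 1) && (s2 == t2) | (t1 == s1 + 1) && (t2 == s2)] by lia.
case/or4P=> /andP[/eqP-> /eqP->];
  [exact: Or41 | exact: Or42 | exact: Or43 | exact: Or44].
Qed.

(* Horizontal steps across the vertical ray going up from [k], displaced by
   half a unit to the left. *)
Definition up_step k : rel pt :=
  [rel s t | [&& s.2 == t.2, k.2 <= s.2 & Num.max s.1 t.1 == k.1]].

Definition up_crossings k x p : bool := crossings (up_step k) x p.

(* Horizontal steps across the vertical ray going down from [k], displaced by
   half a unit to the right. *)
Definition down_step k : rel pt :=
  [rel s t | [&& s.2 == t.2, s.2 <= k.2 & Num.min s.1 t.1 == k.1]].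

Definition down_crossings k x p : bool := crossings (down_step k) x p.

Definition above k s : bool := (s.1 == k.1) && (k.2 <= s.2).

Lemma neq_pt s t : (s != t) = (s.1 != t.1) || (s.2 != t.2).
Proof. by case: s t => [s1 s2] [t1 t2]; rewrite xpair_eqE negb_and. Qed.

Lemma up_crossings_up k x p : path grid_adj x p -> k \notin x :: p ->
  up_crossings k x p = up_crossings (k.1, k.2 + 1) x p.
Proof.
move=> px kx; apply: eq_in_crossings px _ => s t sp tp.
have := memPn kx s sp; have := memPn kx t tp; rewrite !neq_pt /up_step /=.
by move: k.1 k.2 s.1 s.2 t.1 t.2; clear; lia.
Qed.

Lemma up_crossings_right k x p : path grid_adj x p -> k \notin x :: p ->
  up_crossings k x p (+) up_crossings (k.1 + 1, k.2) x p =
    above k x (+) above k (last x p).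
Proof.
move=> px kx; rewrite -crossings_telescope -crossings_addb.
apply: eq_in_crossings px _ => s t sp tp.
have := memPn kx s sp; have := memPn kx t tp.
rewrite !neq_pt /up_step /above /grid_adj /=.
by move: k.1 k.2 s.1 s.2 t.1 t.2; clear; lia.
Qed.

Lemma up_crossings_step s t x p : path grid_adj x p -> grid_adj s t ->
  s \notin x :: p -> t \notin x :: p ->
  up_crossings s x p (+) up_crossings t x p =
    down_step x s t (+) down_step (last x p) s t.
Proof.
have up z : path grid_adj x p -> z \notin x :: p ->
    up_crossings z x p (+) up_crossings (z.1, z.2 + 1) x p =
    down_step x z (z.1, z.2 + 1) (+) down_step (last x p) z (z.1, z.2 + 1).
  move=> px zx; rewrite -up_crossings_up // addbb /down_step /=.
  by have -> : (z.2 == z.2 + 1) = false by lia.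
have right z : path grid_adj x p -> z \notin x :: p ->
    up_crossings z x p (+) up_crossings (z.1 + 1, z.2) x p =
    down_step x z (z.1 + 1, z.2) (+) down_step (last x p) z (z.1 + 1, z.2).
  move=> px zx; rewrite up_crossings_right // /above /down_step /= eqxx /=.
  by move: x.1 x.2 (last x p).1 (last x p).2 z.1 z.2; clear; lia.
have down_sym z y y' : down_step z y y' = down_step z y' y.
  by rewrite /down_step /= minC; case: eqVneq => [->|].
move=> px /grid_adjP[]-> sx tx.
- by rewrite addbC !(down_sym _ _ t) up.
- exact: up.
- by rewrite addbC !(down_sym _ _ t) right.
- exact: right.
Qed.

Lemma up_crossings_along k q x p : path grid_adj x p -> path grid_adj k q ->
  (forall s, s \in k :: q -> s \notin x :: p) ->
  up_crossings k x p (+) up_crossings (last k q) x p =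
  down_crossings x k q (+) down_crossings (last x p) k q.
Proof.
move=> px kq off; rewrite -(crossings_telescope (fun s => up_crossings s x p)).
rewrite -crossings_addb; apply: eq_in_crossings kq _ => s t sq tq st.
by apply: up_crossings_step; rewrite ?off.
Qed.

(* The rays going up and down from [i] make up a vertical line. *)
Lemma down_up_crossings i k q : path grid_adj k q -> i \notin k :: q ->
  k.1 != i.1 -> (last k q).1 != i.1 ->
  down_crossings i k q (+) up_crossings i k q = (k.1 <= i.1) (+) ((last k q).1 <= i.1).
Proof.
move=> kq iq ki li; have := up_crossings_right kq iq.
rewrite /above (negPf ki) (negPf li) /= => /(canRL (addbK _)) ->; rewrite addFb.
rewrite -(crossings_telescope (fun s => s.1 <= i.1)) -crossings_addb.
apply: eq_in_crossings kq _ => s t sq tq.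
have := memPn iq s sq; have := memPn iq t tq.
rewrite !neq_pt /down_step /up_step /grid_adj /=.
by move: i.1 i.2 s.1 s.2 t.1 t.2; clear; lia.
Qed.

(* The right-hand side tells whether the ends of the two paths interleave. *)
Lemma up_crossings_swap k q x p : path grid_adj x p -> path grid_adj k q ->
  (forall s, s \in k :: q -> s \notin x :: p) ->
  k.1 != x.1 -> k.1 != (last x p).1 ->
  (last k q).1 != x.1 -> (last k q).1 != (last x p).1 ->
  (up_crossings k x p (+) up_crossings (last k q) x p) (+)
    (up_crossings x k q (+) up_crossings (last x p) k q) =
  ((k.1 <= x.1) (+) ((last k q).1 <= x.1)) (+)
    ((k.1 <= (last x p).1) (+) ((last k q).1 <= (last x p).1)).
Proof.
move=> px kq off kx kl lx ll; rewrite up_crossings_along //.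
have xq : x \notin k :: q by apply/negP => /off; rewrite mem_head.
have lq : last x p \notin k :: q by apply/negP => /off; rewrite mem_last.
by rewrite -(down_up_crossings kq xq) // -(down_up_crossings kq lq) // addbACA.
Qed.

Definition joined S (a b : pt) : Prop := exists p,
  [/\ path grid_adj a p, last a p = b & forall z, z \in a :: p -> S z].

Lemma joined_sub S S' (a b : pt) :
  (forall z, S z -> S' z) -> joined S a b -> joined S' a b.
Proof. by move=> SS' [p [pp pl pS]]; exists p; split=> // z /pS/SS'. Qed.

Lemma joined_trans S (a b c : pt) : joined S a b -> joined S b c -> joined S a c.
Proof.
move=> [p [pp <- pS]] [q [qq <- qS]].
exists (p ++ q); rewrite cat_path last_cat pp qq; split=> // z.
rewrite inE mem_cat orbA => /orP[zp|zq]; first by apply: pS; rewrite inE.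
by apply: qS; rewrite inE zq orbT.
Qed.

Lemma joined_sym S (a b : pt) : joined S a b -> joined S b a.
Proof.
move=> [p [pp <- pS]]; exists (rev (belast a p)); split.
- by rewrite rev_path; apply: sub_path pp => s t; rewrite grid_adj_sym.
- by case: p {pp pS} => [|z p] //=; rewrite rev_cons last_rcons.
- by move=> z; rewrite inE mem_rev => /orP[/eqP->|/mem_belast];
    [apply/pS/mem_last | apply: pS].
Qed.

Lemma joined_corner S (a b : pt) : `|a.1 - b.1| <= 1 -> `|a.2 - b.2| <= 1 ->
  S a -> S (b.1, a.2) -> S b -> joined S a b.
Proof.
have joined1 x y : S x -> S y -> (x != y -> grid_adj x y) -> joined S x y.
  move=> Sx Sy; have [<- _|_ /(_ isT) xy] := eqVneq x y.
    by exists [::]; split=> // z; rewrite inE => /eqP->.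
  by exists [:: y]; split=> [|//|z]; rewrite /= ?xy // !inE => /orP[]/eqP->.
case: a b => [a1 a2] [b1 b2] /= ab1 ab2 Sa Sc Sb.
apply: (@joined_trans _ _ (b1, a2)); apply: joined1 => //; rewrite neq_pt /grid_adj /=.
  by rewrite eqxx orbF subrr normr0 addr0; move: ab1; clear; lia.
by rewrite eqxx subrr normr0 add0r; move: ab2; clear; lia.
Qed.

(* Each pair of disjoint edges of a drawing of K_5 contributes the parity of
   its crossings. Every ray is counted for two pairs, but among the three pairs
   with the same four ends exactly one is interleaved, which makes five in all. *)
Section LatticeK5.
Variables (P : nat -> pt) (q : nat -> nat -> seq pt).
Hypothesis q_path : forall i j : nat, (i < j < 5)%N ->
  path grid_adj (P i) (q i j) /\ last (P i) (q i j) = P j.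
Hypothesis q_disjoint : forall i j k l : nat, (i < j < 5)%N -> (k < l < 5)%N ->
  uniq [:: i; j; k; l] -> forall s, s \in P i :: q i j -> s \notin P k :: q k l.
Hypothesis P_generic : forall i j : nat, (i < j < 5)%N -> (P i).1 != (P j).1.

Definition ray_parity (k i j : nat) : bool := up_crossings (P k) (P i) (q i j).

Definition left_of (i j : nat) : bool := (P i).1 <= (P j).1.

Definition pair_parity (i j k l : nat) : bool :=
  (ray_parity i k l (+) ray_parity j k l) (+) (ray_parity k i j (+) ray_parity l i j).

Lemma pair_parityE (i j k l : nat) :
  (i < j < 5)%N -> (k < l < 5)%N -> uniq [:: i; j; k; l] ->
  pair_parity i j k l = (left_of i k (+) left_of j k) (+) (left_of i l (+) left_of j l).
Proof.
move=> ij kl ijkl; have [[pij lij] [pkl lkl]] := (q_path ij, q_path kl).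
have neq (m n : nat) : (m < 5)%N -> (n < 5)%N -> m != n -> (P m).1 != (P n).1.
  move=> m5 n5; rewrite neq_ltn.
  by case/orP=> mn; [|rewrite eq_sym]; apply: P_generic; rewrite mn.
have := up_crossings_swap pkl pij (q_disjoint ij kl ijkl); rewrite lij lkl; apply;
  apply: neq; move: ij kl ijkl; rewrite /= !inE; clear; lia.
Qed.

Definition quadruple_parity (i j k l : nat) : bool :=
  pair_parity i j k l (+) pair_parity i k j l (+) pair_parity i l j k.

Lemma quadruple_parity_true (i j k l : nat) : (i < j)%N -> (j < k)%N -> (k < l < 5)%N ->
  quadruple_parity i j k l = true.
Proof.
move=> ij jk /andP[kl l5]; rewrite /quadruple_parity !pair_parityE /= ?inE;
  try by move: ij jk kl l5; clear; lia.
have left_anti (m n : nat) : (m < n < 5)%N -> left_of n m = ~~ left_of m n.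
  by move=> mn; rewrite /left_of -ltNge lt_neqAle eq_sym P_generic.
rewrite (left_anti j k) ?(left_anti j l) ?(left_anti k l);
  by move: ij jk kl l5; clear; lia.
Qed.

Lemma quadruple_parity_sum : quadruple_parity 0 1 2 3 (+) quadruple_parity 0 1 2 4 (+)
  quadruple_parity 0 1 3 4 (+) quadruple_parity 0 2 3 4 (+)
    quadruple_parity 1 2 3 4 = false.
Proof.
have addb_xorb b c : b (+) c = xorb b c by case: b; case: c.
by rewrite /quadruple_parity /pair_parity !addb_xorb; btauto.
Qed.

Lemma lattice_paths_K5 : False.
Proof. by have := quadruple_parity_sum; rewrite !quadruple_parity_true. Qed.

End LatticeK5.

Lemma lattice_K5 (P : nat -> pt) (S : nat -> nat -> pt -> Prop) :
  (forall i j : nat, (i < j < 5)%N -> joined (S i j) (P i) (P j)) ->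
  (forall i j k l : nat, (i < j < 5)%N -> (k < l < 5)%N -> uniq [:: i; j; k; l] ->
     forall z, S i j z -> ~ S k l z) ->
  (forall i j : nat, (i < j < 5)%N -> (P i).1 != (P j).1) -> False.
Proof.
move=> P_joined S_disjoint P_generic.
have path_exists (ij : 'I_5 * 'I_5) : exists p, (ij.1 < ij.2)%N ->
    [/\ path grid_adj (P ij.1) p, last (P ij.1) p = P ij.2 &
        forall z, z \in P ij.1 :: p -> S ij.1 ij.2 z].
  have [ij_lt|_] := boolP (ij.1 < ij.2)%N; last by exists [::].
  by have [|p] := P_joined ij.1 ij.2; [rewrite ij_lt ltn_ord | exists p].
have [f f_path] := fin_all_exists path_exists.
pose q (i j : nat) := f (inord i, inord j).
have q_path (i j : nat) : (i < j < 5)%N -> [/\ path grid_adj (P i) (q i j),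
    last (P i) (q i j) = P j & forall z, z \in P i :: q i j -> S i j z].
  case/andP=> ij j5; have i5 := ltn_trans ij j5.
  by have := f_path (inord i, inord j); rewrite /= !inordK //; apply.
apply: (@lattice_paths_K5 P q) => // [i j|i j k l ij kl ijkl s s_ij].
  by case/q_path.
apply/negP => s_kl; have [_ _ q_ij] := q_path i j ij; have [_ _ q_kl] := q_path k l kl.
exact: S_disjoint ij kl ijkl s (q_ij s s_ij) (q_kl s s_kl).
Qed.

End Lattice.

(** * Planarity *)

From mathcomp Require Import boolp classical_sets.
From mathcomp Require Import topology normedtype.

Import numFieldNormedType.Exports.

Section Compactness.
Local Open Scope classical_set_scope.
Local Open Scope ring_scope.
Variable R : realFieldType.

Lemma compact_closed_apart (T : pseudoMetricType R) (K L : set T) :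
  compact K -> closed L -> K `&` L = set0 ->
  \forall e \near 0^'+, forall x y, K x -> L y -> ~ ball x e y.
Proof.
move=> /compact_near_coveringP K_cov L_closed KL0.
suff : \forall e \near 0^'+, K `<=` [set x | forall y, L y -> ~ ball x e y].
  by apply: filterS => e Ke x y Kx; apply: Ke.
apply: K_cov => x Kx.
have /nbhs_ballP[d /= d_gt0 dL] : nbhs x (~` L).
  by apply: open_nbhs_nbhs; split;
    [exact: closed_openC | move=> Lx; rewrite -[False]/(set0 x) -KL0].
near=> x' e => /= y Ly x'y; apply: (dL y) Ly.
rewrite [d]splitr; apply: (@ball_triangle _ _ x').
  by near: x'; apply: nbhsx_ballx; rewrite divr_gt0.
apply: le_ball x'y; near: e; apply: nbhs_right_le; exact: divr_gt0.
Unshelve. all: by end_near. Qed.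

Lemma compact_uniformly_continuous (T U : pseudoMetricType R) (K : set T)
  (f : T -> U) e :
  compact K -> {within K, continuous f} -> 0 < e ->
  \forall d \near 0^'+, forall x y, K x -> K y -> ball x d y -> ball (f x) e (f y).
Proof.
move=> /compact_near_coveringP/near_covering_withinP K_cov.
move=> /subspace_continuousP fK e_gt0.
suff : \forall d \near 0^'+,
    K `<=` [set x | forall y, K y -> ball x d y -> ball (f x) e (f y)].
  by apply: filterS => d Kd x y Kx; apply: Kd.
apply: K_cov => x Kx; have e2 : 0 < e / 2 by rewrite divr_gt0.
have /cvg_ballP/(_ _ e2) := fK x Kx; rewrite near_withinE => /nbhs_ballP[d /= d_gt0 fd].
near=> x' c => /= Kx' y Ky x'y; rewrite [e]splitr.
have xx' : ball x (d / 2) x' by near: x'; apply: nbhsx_ballx; rewrite divr_gt0.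
apply: (@ball_triangle _ _ (f x)).
  apply/ball_sym/fd => //; apply: le_ball xx'.
  by rewrite ler_pdivrMr // ler_pMr // ler1n.
apply: fd => //; rewrite [d]splitr; apply: ball_triangle xx' _; apply: le_ball x'y.
near: c; apply: nbhs_right_le; exact: divr_gt0.
Unshelve. all: by end_near. Qed.

End Compactness.

Section Rounding.
Local Open Scope classical_set_scope.
Local Open Scope ring_scope.
Variable R : realType.
Local Notation pt := (int * int)%type.
Implicit Types (N a t : R) (A : set (R * R)) (x y z : R * R) (k : pt).

Definition round N z : pt := (Num.floor (N * z.1), Num.floor (N * z.2)).

Definition near_pt N A k : Prop := exists2 w, A w &
  `|k.1%:~R - N * w.1| <= 2 /\ `|k.2%:~R - N * w.2| <= 2.

Lemma near_pt_apart A A' : compact A -> compact A' -> A `&` A' = set0 ->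
  \forall N \near +oo, forall k, near_pt N A k -> ~ near_pt N A' k.
Proof.
move=> A_compact /(compact_closed (@norm_hausdorff _ _)) A'_closed AA'0.
have [e [e_gt0 e_apart]] : exists e, 0 < e /\ forall x y, A x -> A' y -> ~ ball x e y.
  apply: (@filter_ex _ (0^'+ : set_system R)).
  by apply: filterI; [exact: nbhs_right_gt | exact: compact_closed_apart].
have dist4 N (a a' c : R) :
    `|c - N * a| <= 2 -> `|c - N * a'| <= 2 -> 4 < N * e -> 0 < N ->
    `|a - a'| < e.
  move=> ca ca' Ne N_gt0; rewrite -(ltr_pM2l N_gt0) -{1}(gtr0_norm N_gt0) -normrM.
  apply: le_lt_trans Ne; have -> : N * (a - a') = (c - N * a') - (c - N * a) by lra.
  by apply: le_trans (ler_normB _ _) _; lra.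
near=> N => k [w Aw [w1 w2]] [w' Aw' [w'1 w'2]].
have N_gt : 4 / e < N by near: N; apply: nbhs_pinfty_gt; rewrite num_real.
have N_gt0 : 0 < N by apply: lt_trans N_gt; rewrite divr_gt0.
rewrite ltr_pdivrMr // in N_gt.
by apply: (e_apart _ _ Aw Aw'); split;
  [apply: dist4 w1 w'1 _ _ | apply: dist4 w2 w'2 _ _].
Unshelve. all: by end_near. Qed.

Lemma floor_apart a a' : a != a' ->
  \forall N \near +oo, Num.floor (N * a) != Num.floor (N * a').
Proof.
move=> aa'; near=> N; apply/eqP => floor_eq.
have N_gt : `|a - a'|^-1 < N by near: N; apply: nbhs_pinfty_gt; rewrite num_real.
have aa'_gt0 : 0 < `|a - a'| by rewrite normr_gt0 subr_eq0.
have : 1 < `|N * a - N * a'|.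
  have N_gt0 : 0 < N by apply: lt_trans N_gt; rewrite invr_gt0.
  by rewrite -mulrBr normrM (gtr0_norm N_gt0) -ltr_pdivrMr // div1r.
apply/negP; rewrite -leNgt; apply/ltW.
have := floor_itv (N * a); have := floor_itv (N * a'); rewrite floor_eq intrD.
by rewrite ltr_norml => /andP[? ?] /andP[? ?]; apply/andP; split; lra.
Unshelve. all: by end_near. Qed.

Lemma dist_floor_le1 a a' : `|a - a'| < 1 -> `|Num.floor a - Num.floor a'| <= 1.
Proof.
rewrite ltr_norml => /andP[aa'_gt aa'_lt]; rewrite ler_norml lerBrDr lerBlDr.
have /andP[a_floor floor_a] := floor_itv a.
have /andP[a'_floor floor_a'] := floor_itv a'.
rewrite !intrD in floor_a floor_a'.
by apply/andP; split; rewrite -ltzD1 -(ltr_int R) !intrD; lra.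
Qed.

Lemma dist_floor_le2 a a' : `|a - a'| < 1 -> `|(Num.floor a')%:~R - a| <= 2.
Proof.
rewrite ltr_norml => /andP[aa'_gt aa'_lt].
have /andP[a'_floor floor_a'] := floor_itv a'.
by rewrite intrD in floor_a'; rewrite ler_norml; apply/andP; split; lra.
Qed.

Lemma joined_round N A x y :
  A x -> `|N * x.1 - N * y.1| < 1 -> `|N * x.2 - N * y.2| < 1 ->
  joined (near_pt N A) (round N x) (round N y).
Proof.
move=> Ax xy1 xy2; have aa_lt1 a : `|a - a| < 1 :> R by rewrite subrr normr0.
apply: joined_corner; rewrite ?dist_floor_le1 //.
all: by exists x => //; split; apply: dist_floor_le2.
Qed.

Lemma joined_curve N (f : R -> R * R) : 0 < N -> {within `[0, 1], continuous f} ->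
  joined (near_pt N (f @` `[0, 1])) (round N (f 0)) (round N (f 1)).
Proof.
move=> N_gt0 f_cont; have Ninv_gt0 : 0 < N^-1 by rewrite invr_gt0.
have [d [d_gt0 f_unif]] : exists d, 0 < d /\
    forall a b : R, a \in `[0, 1] -> b \in `[0, 1] -> ball a d b ->
      ball (f a) N^-1 (f b).
  apply: (@filter_ex _ (0^'+ : set_system R)); apply: filterI.
    exact: nbhs_right_gt.
  by apply: compact_uniformly_continuous f_cont Ninv_gt0; apply: segment_compact.
have dist_lt1 (a b : R) : `|a - b| < N^-1 -> `|N * a - N * b| < 1.
  by move=> ab; rewrite -mulrBr normrM (gtr0_norm N_gt0) mulrC -ltr_pdivlMr // div1r.
pose n := Num.bound d^-1.
have n_gt : d^-1 < n%:R by apply: archi_boundP; rewrite invr_ge0 ltW.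
have n_gt0 : 0 < n%:R :> R by apply: lt_trans n_gt; rewrite invr_gt0.
have unit_div (k : nat) : (k <= n)%N -> (k%:R / n%:R : R) \in `[0, 1].
  move=> kn; rewrite in_itv /=; apply/andP; split; first exact: divr_ge0.
  by rewrite ler_pdivrMr // mul1r ler_nat.
suff joined_k (k : nat) : (k <= n)%N ->
    joined (near_pt N (f @` `[0, 1])) (round N (f 0)) (round N (f (k%:R / n%:R))).
  by have := joined_k n (leqnn n); rewrite divff // gt_eqF.
elim: k => [_|k IHk kn].
  rewrite mul0r; apply: joined_round; rewrite ?subrr ?normr0 //.
  by exists 0; rewrite //= in_itv /= lexx ler01.
apply: joined_trans (IHk (ltnW kn)) _.
have [|ball1 ball2] :=
  f_unif (k%:R / n%:R) (k.+1%:R / n%:R) (unit_div k (ltnW kn)) (unit_div _ kn).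
  rewrite /ball /= -mulrBl -natr1 opprD addNKr mulN1r normrN gtr0_norm ?invr_gt0 //.
  by rewrite -[d]invrK ltf_pV2 ?posrE ?invr_gt0.
apply: joined_round; [| exact: dist_lt1 ball1 | exact: dist_lt1 ball2].
by exists (k%:R / n%:R) => //; apply: unit_div; apply: ltnW.
Qed.

End Rounding.

Section Shear.
Local Open Scope classical_set_scope.
Local Open Scope ring_scope.
Variable R : realType.
Implicit Types (t : R) (z : R * R).

Definition shear t z : R * R := (z.1 + t * z.2, z.2).

Lemma shear_inj t : injective (shear t).
Proof. by move=> [x y] [x' y'] [/[swap] ->] /addIr ->. Qed.

Lemma shear_continuous t : continuous (shear t).
Proof.
move=> z; apply: (@cvg_pair _ _ _ _ (nbhs (z.1 + t * z.2)) (nbhs z.2));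
  last exact: cvg_snd.
by apply: cvgD; [exact: cvg_fst | apply: cvgM; [exact: cvg_cst | exact: cvg_snd]].
Qed.

Lemma shear_generic2 z z' : z <> z' ->
  \forall t \near 0^'+, (shear t z).1 != (shear t z').1.
Proof.
move=> zz'.
have shear_eq t : ((shear t z).1 == (shear t z').1) = (z.1 - z'.1 == t * (z'.2 - z.2)).
  by rewrite -subr_eq0 -[RHS]subr_eq0 /=; congr (_ == 0); ring.
have [z2|z2] := eqVneq z.2 z'.2.
  apply: nearW => t; rewrite shear_eq z2 subrr mulr0 subr_eq0.
  apply/eqP => z1; apply: zz'.
  by case: z z' z1 z2 {shear_eq} => [? ?] [? ?] /= -> ->.
have {}shear_eq t :
    ((shear t z).1 == (shear t z').1) = ((z.1 - z'.1) / (z'.2 - z.2) == t).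
  have z2_neq0 : z'.2 - z.2 != 0 by rewrite subr_eq0 eq_sym.
  by rewrite shear_eq; apply/eqP/eqP => [->|<-]; rewrite ?mulfK ?divfK.
under eq_near do rewrite shear_eq; set c := _ / _.
have [c_gt0|c_le0] := ltP 0 c.
  by apply: filterS (nbhs_right_lt c_gt0) => t /lt_eqF; rewrite eq_sym => ->.
by apply: filterS (nbhs_right_gt 0) => t /(le_lt_trans c_le0)/lt_eqF ->.
Qed.

Lemma shear_generic (I : finType) (x : I -> R * R) : injective x ->
  \forall t \near 0^'+, injective (fun i => (shear t (x i)).1).
Proof.
move=> x_inj; have : \forall t \near 0^'+, forall ij : I * I,
    ij.1 != ij.2 -> (shear t (x ij.1)).1 != (shear t (x ij.2)).1.
  apply: filter_forall => -[i j] /=; have [_|ij] := eqVneq i j; first exact: nearW.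
  have xij : x i <> x j by move=> /x_inj ij'; rewrite ij' eqxx in ij.
  by apply: filterS (shear_generic2 xij).
apply: filterS => t t_generic i j; apply: contra_eq => ij; exact: (t_generic (i, j)).
Qed.

End Shear.

Section Drawing.
Local Open Scope ring_scope.
Variables (R : realType) (V : finType) (G : plane_graph R V).
Implicit Types (e : {set V}) (u v : V) (N t : R) (X : {set V}).
Local Notation pt := (int * int)%type.

Lemma curve_compact e : e \in edges G -> compact (curve G e).
Proof.
case/edge_arc=> u [v [_ _ [f [f_cont _ _ _ ->]]]].
by apply: continuous_compact f_cont _; apply: segment_compact.
Qed.

Lemma curve_disjoint e e' : e \in edges G -> e' \in edges G -> [disjoint e & e'] ->
  (curve G e `&` curve G e' = set0)%classic.
Proof.
move=> eG e'G ee'; have e_neq : e != e'.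
  apply: contraTneq ee' => <-; have [u [v [_ -> _]]] := edge_arc eG.
  by apply/pred0Pn; exists u; rewrite /= !inE eqxx.
apply/seteqP; split=> // z [ze ze'].
have [w _ wz] := edge_edge eG e'G e_neq (conj ze ze').
have we : w \in e by apply: (edge_vertex eG); rewrite wz.
have we' : w \in e' by apply: (edge_vertex e'G); rewrite wz.
by move: (disjointFr ee' we); rewrite we'.
Qed.

Definition sheared t e : set (R * R) := (shear t @` curve G e)%classic.

Lemma sheared_apart t e e' : e \in edges G -> e' \in edges G -> [disjoint e & e'] ->
  \forall N \near +oo, forall k, near_pt N (sheared t e) k ->
    ~ near_pt N (sheared t e') k.
Proof.
move=> eG e'G ee'; have sheared_compact e0 : e0 \in edges G -> compact (sheared t e0).
  move=> e0G; apply: continuous_compact (curve_compact e0G).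
  by apply: continuous_subspaceT; apply: shear_continuous.
apply: near_pt_apart; [exact: sheared_compact | exact: sheared_compact |].
apply/seteqP; split=> // _ [[z ze <-] [z' z'e' /shear_inj z'z]].
have : (curve G e `&` curve G e')%classic z by split; rewrite // -z'z.
by rewrite curve_disjoint.
Qed.

Definition vertex_pt N t v : pt := round N (shear t (pos G v)).

Lemma edge_joined N t u v : 0 < N -> adj G u v ->
  joined (near_pt N (sheared t [set u; v]%SET)) (vertex_pt N t u) (vertex_pt N t v).
Proof.
move=> N_gt0 uv; have [u' [v' [u'v' uvE [f [f_cont _ f0 f1 fE]]]]] := edge_arc uv.
have shear_f_cont : {within `[0, 1], continuous (shear t \o f)}%classic.
  by apply: within_continuous_comp f_cont => z _; apply: shear_continuous.
have u'v'_joined :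
    joined (near_pt N (sheared t [set u; v]%SET)) (vertex_pt N t u') (vertex_pt N t v').
  rewrite /sheared /vertex_pt fE image_comp -f0 -f1.
  exact: (joined_curve N_gt0 shear_f_cont).
have : u \in [set u'; v']%SET by rewrite -uvE !inE eqxx.
have : v \in [set u'; v']%SET by rewrite -uvE !inE eqxx orbT.
have : u != v by apply: contraTneq uv => ->; rewrite adj_irrefl.
move: (sheared t _) u'v'_joined => A u'v'_joined; rewrite !inE => uv_neq.
case/orP=> /eqP vE /orP[]/eqP uE; rewrite vE uE ?eqxx // in uv_neq *.
exact: joined_sym.
Qed.

Definition near_edge_in N t X (k : pt) : Prop :=
  exists e, [/\ e \in edges G, e \subset X & near_pt N (sheared t e) k].

Lemma connect_joined N t X u v : 0 < N -> connect (induced (adj G) X) u v -> u != v ->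
  joined (near_edge_in N t X) (vertex_pt N t u) (vertex_pt N t v).
Proof.
move=> N_gt0; have joined1 x y : induced (adj G) X x y ->
    joined (near_edge_in N t X) (vertex_pt N t x) (vertex_pt N t y).
  case/and3P=> xX yX xy; apply: joined_sub (edge_joined t N_gt0 xy) => k k_near.
  exists [set x; y]%SET; split=> //.
  by apply/fintype.subsetP => w; rewrite !inE => /orP[]/eqP->.
move=> /connectP[p pp ->]; elim: p u pp => [|w p IHp] u /=; first by rewrite eqxx.
move=> /andP[uw pw] _; have [<-|w_neq] := eqVneq w (last w p); first exact: joined1.
exact: joined_trans (joined1 _ _ uw) (IHp _ pw w_neq).
Qed.

Definition separating N t : Prop := forall e e',
  e \in edges G -> e' \in edges G -> [disjoint e & e'] ->
  forall k, near_pt N (sheared t e) k -> ~ near_pt N (sheared t e') k.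

Lemma all_sheared_apart t : \forall N \near +oo, separating N t.
Proof.
have : \forall N \near +oo, forall ee : {set V} * {set V},
    ee.1 \in edges G -> ee.2 \in edges G -> [disjoint ee.1 & ee.2] ->
    forall k, near_pt N (sheared t ee.1) k -> ~ near_pt N (sheared t ee.2) k.
  apply: filter_forall => -[e e'] /=.
  have [eG|] := boolP (e \in edges G); last by move=> _; apply: nearW.
  have [e'G|] := boolP (e' \in edges G); last by move=> _; apply: nearW.
  have [ee'|] := boolP [disjoint e & e']; last by move=> _; apply: nearW.
  by apply: filterS (sheared_apart t eG e'G ee') => N N_apart _ _ _.
by apply: filterS => N N_apart e e'; apply: (N_apart (e, e')).
Qed.

Lemma generic_scale (n : nat) (c : nat -> V) :
  (forall i j, (i < j < n)%N -> c i != c j) ->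
  exists N t, [/\ 0 < N, separating N t &
    forall i j, (i < j < n)%N -> (vertex_pt N t (c i)).1 != (vertex_pt N t (c j)).1].
Proof.
move=> c_neq.
have [t t_generic] := @filter_ex _ _ (at_right_proper_filter (0 : R)) _
  (shear_generic (@pos_inj _ _ G)).
have [N [N_gt0 N_apart N_floor]] : exists N, [/\ 0 < N, separating N t &
    forall uv : V * V, uv.1 != uv.2 ->
      (vertex_pt N t uv.1).1 != (vertex_pt N t uv.2).1].
  near (pinfty_nbhs R) => N; exists N; split.
  - by near: N; apply: nbhs_pinfty_gt; rewrite num_real.
  - by near: N; apply: all_sheared_apart.
  - near: N; apply: filter_forall => -[u v] /=.
    have [_|uv] := eqVneq u v; first exact: nearW.
    apply: (@filterS _ _ _ _ _ _ (floor_apart _)); last first.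
      by apply: contra_neq uv; apply: t_generic.
    by [].
by exists N, t; split=> // i j ij; apply: (N_floor (c i, c j)); apply: c_neq.
Unshelve. all: by end_near. Qed.

Lemma plane_no_K5 : ~ clique_minor (adj G) 5.
Proof.
case/clique_minor_branches=> B [c [cB B_disjoint B_joined]].
have c_neq i j : (i < j < 5)%N -> c i != c j.
  move=> ij; have [i5 j5] : (i < 5)%N /\ (j < 5)%N by move: ij; clear; lia.
  apply: contraTneq (cB j j5) => <-.
  by rewrite (disjointFr (B_disjoint i j ij) (cB i i5)).
have [N [t [N_gt0 N_apart N_generic]]] := generic_scale c_neq.
apply: (@lattice_K5 (fun i => vertex_pt N t (c i))
  (fun i j => near_edge_in N t (B i :|: B j))) => //.
  by move=> i j ij; apply: connect_joined => //; [apply: B_joined | apply: c_neq].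
move=> i j k l ij kl ijkl z [e [eG eB z_e]] [e' [e'G e'B z_e']].
apply: (N_apart e e' eG e'G _ z z_e z_e').
apply: disjointWl eB _; apply: disjointWr e'B _.
have B_disjoint' m n : (m < 5)%N -> (n < 5)%N -> m != n -> [disjoint B m & B n].
  move=> m5 n5; rewrite neq_ltn => /orP[mn|nm]; first by apply: B_disjoint; rewrite mn.
  by rewrite disjoint_sym; apply: B_disjoint; rewrite nm.
apply/pred0P => v /=; apply/negP; rewrite !inE => /andP[/orP[v_ij|v_ij] /orP[]];
  rewrite (disjointFr _ v_ij) // B_disjoint' //;
  by move: ij kl ijkl; rewrite /= !inE; clear; lia.
Qed.

End Drawing.

Lemma fortification_refl (R : realType) (V : finType) (G : plane_graph R V) :
  fortification G G.
Proof.
split=> //; exists (fun=> classical_sets.set0).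
by split=> [e|e e'|e]; rewrite finset.setDv inE.
Qed.

Lemma spans_zspans (V : finType) (e : rel V) (H : {set {set V}}) z :
  spans e H -> zspans e H z.
Proof.
move=> e_spans u v /e_spans[A AH /andP[uA vA]].
by exists A, A; split=> //; apply: dist_le_refl.
Qed.

Theorem theorem5p2 (R : realType) (V : finType) (G : plane_graph R V)
    (H : {set {set V}})
    (H_connected : forall A : {set V}, A \in H -> connected_set (adj G) A)
    (H_spans : spans (adj G) H) :
  exists (G' : plane_graph R V) (M : {set {set V}}),
    [/\ fortification G G',
        zspans (adj G') H 8 &
        impression (adj G') H M 73936 80].
Proof.
have [M M_impression] := clique_minor_free_impression (@adj_sym _ _ G) H_spans
  H_connected (@plane_no_K5 _ _ G).
exists G, M; split.
- exact: fortification_refl.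
- exact: spans_zspans.
- exact: impression_leq M_impression.
Qed.
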